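(* Let $H$ be a separable infinite-dimensional complex Hilbert space, let $T\in B(H)$ satisfy $0\in\operatorname{Int}\widehat\sigma(T)$, and let $k\in\mathbb N$. Then there exists $\delta>0$ with the following property: if $B\subset(\mathbb N\times\mathbb N)\setminus\Delta$ is admissible, and $\{a_{nj}=(a_{nj}^{(1)},\dots,a_{nj}^{(k)}):(n,j)\in B\cup\Delta\}\subset\mathbb C^k$ is such that $$\sum_{j:(n,j)\in B\cup\Delta}\|a_{nj}\|_\infty\le\delta\ \text{ for all }n\in\mathbb N\quad\text{and}\quad\sum_{n:(n,j)\in B\cup\Delta}\|a_{nj}\|_\infty\le\delta\ \text{ for all }j\in\mathbb N,$$ then there is an orthonormal basis $(u_n)_{n=1}^\infty$ of $H$ satisfying $$\langle T^lu_j,u_n\rangle=a_{nj}^{(l)}$$ for all $l=1,\dots,k$ and all $n,j\in\mathbb N$ with $(n,j)\in B\cup\Delta$. In particular, for every admissible $B\subset(\mathbb N\times\mathbb N)\setminus\Delta$ there exists an orthonormal basis $(u_n)_{n=1}^\infty$ of $H$ such that $\langle T^lu_j,u_n\rangle=0$ for all $l=1,\dots,k$ and all $n,j\in\mathbb N$ with $(n,j)\in B\cup\Delta$.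
   Context: $B(H)$ is the space of bounded linear operators on $H$; $\mathbb N=\{1,2,\dots\}$. $\sigma(T)$ is the spectrum of $T$, and $\widehat\sigma(T)$ its polynomial hull, where for compact $K\subset\mathbb C$, $\widehat K=\{\lambda\in\mathbb C:|p(\lambda)|\le\sup_{z\in K}|p(z)|\text{ for all polynomials }p\}$ (equivalently, the union of $K$ with all bounded components of $\mathbb C\setminus K$). $\operatorname{Int}$ denotes the interior. For $\lambda\in\mathbb C^k$, $\|\lambda\|_\infty=\max\{|\lambda_1|,\dots,|\lambda_k|\}$. $\Delta=\{(n,n):n\in\mathbb N\}$. A set $B\subset(\mathbb N\times\mathbb N)\setminus\Delta$ is admissible if for every $m\in\mathbb N$ there exists $n\in\mathbb N$, $n>m$, such that $(j,n)\notin B$ and $(n,j)\notin B$ for all $j=1,\dots,m$. *)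

(* Defs.v *)
From HB Require Import structures.
From mathcomp Require Import all_boot all_order all_algebra.
From mathcomp Require Import all_classical all_reals all_analysis.
From mathcomp Require Import complex.

Set Implicit Arguments.
Unset Strict Implicit.
Unset Printing Implicit Defensive.

Import Order.TTheory GRing.Theory Num.Theory.
Import numFieldNormedType.Exports.

Local Open Scope classical_set_scope.
Local Open Scope ring_scope.

(* The real-valued modulus; the library's [`|z|] for [z : R[i]] is a
   nonnegative element of [R[i]]. *)
Definition cmod (R : realType) (z : R[i]) : R := Normc.normc z.

(* A complete normed space over R[i] is a Hilbert space for the inner product
   [ip] (linear in the first variable, conjugate-linear in the second,
   positive definite) when its norm is the one induced by [ip]. *)
Definition induces_norm (R : realType) (H : completeNormedModType R[i])
    (ip : {dot H for Num.conj}) : Prop :=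
  forall x : H, `|x| ^+ 2 = ip x x.

Definition separable (T : topologicalType) : Prop :=
  exists A : set T, countable A /\ dense A.

Definition lin_span (K : fieldType) (V : lmodType K) (I : choiceType)
    (u : I -> V) : set V :=
  [set x | exists (s : seq I) (c : I -> K), x = \sum_(i <- s) c i *: u i].

Definition infinite_dimensional (K : fieldType) (V : lmodType K) : Prop :=
  forall (n : nat) (v : 'I_n -> V), lin_span v <> setT.

Definition bounded_operator (K : numFieldType) (V : normedModType K)
    (T : {linear V -> V}) : Prop :=
  exists M : K, forall x : V, `|T x| <= M * `|x|.

Definition spectrum (K : numFieldType) (V : normedModType K)
    (T : {linear V -> V}) : set K :=
  [set lambda | ~ exists S : {linear V -> V},
     bounded_operator S /\
     (forall x, S (T x - lambda *: x) = x) /\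
     (forall x, T (S x) - lambda *: S x = x)].

(* The supremum is taken in the extended reals, so that no convention is
   needed for unbounded sets of values. *)
Definition polynomial_hull (R : realType) (K : set R[i]) : set R[i] :=
  [set lambda | forall p : {poly R[i]},
     ((cmod p.[lambda])%:E <=
        ereal_sup [set (cmod p.[z])%:E | z in K])%E].

(* [R[i]^o] is the copy of R[i] that carries the topology of the modulus. *)
Definition complex_interior (R : realType) (A : set R[i]) : set R[i] :=
  interior (A : set R[i]^o).

Definition supnorm (R : realType) (k : nat) (v : 'rV[R[i]]_k) : R :=
  \big[Num.max/0]_(l < k) cmod (v ord0 l).

Definition orthonormal_basis (R : realType) (H : completeNormedModType R[i])
    (ip : {dot H for Num.conj}) (u : nat -> H) : Prop :=
  (forall n j, ip (u n) (u j) = (n == j)%:R) /\ closure (lin_span u) = setT.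

(* The index set {1, 2, ...} is represented by [nat] through n |-> n - 1: the
   notions below depend only on the order of the indices. *)
Definition diagonal : set (nat * nat) := [set p | p.1 = p.2].

Definition admissible (B : set (nat * nat)) : Prop :=
  B `<=` ~` diagonal /\
  forall m : nat, exists n : nat, (m < n)%N /\
    forall j : nat, (j <= m)%N -> ~ B (j, n) /\ ~ B (n, j).

(* Main.v *)
Require Import Defs.
From HB Require Import structures.
From mathcomp Require Import all_boot all_order all_algebra.
From mathcomp Require Import all_classical all_reals all_analysis.
From mathcomp Require Import complex.
From mathcomp Require Import ring lra zify.

Set Implicit Arguments.
Unset Strict Implicit.
Unset Printing Implicit Defensive.

Import Order.TTheory GRing.Theory Num.Theory.
Import numFieldNormedType.Exports.

Local Open Scope classical_set_scope.
Local Open Scope ring_scope.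

(** Let [Vx = (<T x, x>, ..., <T^k x, x>)].  The first point is that, for some
    [kappa > 0] and every finite set [F], all vectors of [C^k] of size at most
    [kappa] are values [Vx] of unit vectors [x] orthogonal to [F].  If some
    direction [c] were missing, then [p(z) = c_1 z + ... + c_k z^k] would satisfy
    [Re p(T) >= -eps] on a subspace of finite codimension, so [p(T) - mu] would be
    invertible for all but finitely many [mu] with [Re mu <= -3 eps]; but
    [Re p] is at most [-4 eps] at infinitely many points near [0] (average over
    circles), and the polynomial [prod (p - mu_i) (1 - rho p)^N] then separates
    such a point from the spectrum, against [0] being interior to the hull.
    Once every direction is available, a greedy choice of pieces of masses
    [th (1 - th)^n], mutually orthogonal under [1, T, ..., T^k] and their adjoints,
    reaches a prescribed value [Vx] exactly, since the residual stays bounded by a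
    multiple of the remaining mass.

    For the basis, each linked pair [(n, j)] gets its own pieces [p] in [u_j] and
    [q] in [u_n] with [<T^l p, q>] and [<T^l q, p>] prescribed and no contribution
    to the diagonal; the masses [|p|^2 = |q|^2] are comparable to [|a_nj| + |a_jn|],
    so the row and column bounds make the [u_n] converge.  Completeness comes from
    the indices provided by admissibility: such a [u_n] also receives a small
    multiple of the part of a target vector orthogonal to the earlier (partial)
    vectors, and by Bessel's inequality that part becomes arbitrarily small. *)

(** Two obstacles shape the basis construction. The part of [u_n] that serves completeness is
    dictated by its target, so its pairings with earlier vectors under the powers of [T] cannot be
    prescribed. For [j < prv n] this is harmless, as admissibility removes those pairs. An index
    between [prv n] and [n] may still be linked to [n]; there [u_j] must be [T]-orthogonal to that
    part, so nonzero targets are spaced out and every later piece is chosen [T]-orthogonal to the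
    targets and to the older pieces. The other obstacle is the norm: [u_j] is changed at infinitely
    many steps, yet must end with norm exactly 1. The total mass [s j] of its linking pieces is
    fixed by the array before the construction starts, so it is reserved at birth and spent step by
    step; the partial vector has squared norm 1 minus the unspent reserve. With rows and columns
    bounded by [kap / 8] the reserve is at most 1/4. The target part takes at most another 1/4, and
    the remaining half suffices to adjust the diagonal values. *)

Local Notation normc := Normc.normc.
Local Notation Re := complex.Re.
Local Notation Im := complex.Im.

(** * Complex modulus and Hilbert spaces *)

Section ComplexModulus.
Variable R : realType.
Implicit Types z w : R[i].

Lemma ReD z w : Re (z + w) = Re z + Re w. Proof. by case: z; case: w. Qed.
Lemma ReN z : Re (- z) = - Re z. Proof. by case: z. Qed.
Lemma ReB z w : Re (z - w) = Re z - Re w. Proof. by rewrite ReD ReN. Qed.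
Lemma ReJ z : Re (z^*)%C = Re z. Proof. by case: z. Qed.
Lemma ReZ (a : R) z : Re (a%:C%C * z) = a * Re z.
Proof. by case: z => x y /=; rewrite mul0r subr0. Qed.

Lemma Re_sum (I : Type) (r : seq I) (P : pred I) (F : I -> R[i]) :
  Re (\sum_(i <- r | P i) F i) = \sum_(i <- r | P i) Re (F i).
Proof. by apply: (big_morph (@complex.Re R)) => [z w|//]; rewrite ReD. Qed.

Lemma conjcD z w : ((z + w)^*)%C = ((z^*)%C + (w^*)%C).
Proof. by case: z; case: w => a b c d; apply/eqP; rewrite eq_complex /= opprD !eqxx. Qed.

Lemma conjcM z w : ((z * w)^*)%C = ((z^*)%C * (w^*)%C).
Proof.
case: z; case: w => a b c d; apply/eqP; rewrite eq_complex /=.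
by apply/andP; split; apply/eqP; ring.
Qed.

Lemma normc_ge0 z : 0 <= normc z.
Proof. by case: z => a b /=; rewrite sqrtr_ge0. Qed.

Lemma normcD z w : normc (z + w) <= normc z + normc w.
Proof. exact: le_normcD. Qed.

Lemma normc0P z : normc z = 0 -> z = 0.
Proof. exact: Normc.eq0_normc. Qed.

Lemma normc_eq0 z : (normc z == 0) = (z == 0).
Proof. by apply/eqP/eqP => [/normc0P//|->]; rewrite Normc.normc0. Qed.

Lemma sqr_normc_Re_Im z : normc z ^+ 2 = Re z ^+ 2 + Im z ^+ 2.
Proof.
by case: z => a b /=; rewrite sqr_sqrtr // addr_ge0 // sqr_ge0.
Qed.

Lemma mulcJ z : z * (z^*)%C = (normc z ^+ 2)%:C%C.
Proof.
rewrite sqr_normc_Re_Im; case: z => a b /=; apply/eqP; rewrite eq_complex /=.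
by apply/andP; split; apply/eqP; ring.
Qed.

Lemma normc_conjc z : normc (z^*)%C = normc z.
Proof. by case: z => a b /=; rewrite sqrrN. Qed.

Lemma normcR (a : R) : normc a%:C%C = `|a|.
Proof. by rewrite /= expr0n addr0 sqrtr_sqr. Qed.

Lemma normcX z n : normc (z ^+ n) = normc z ^+ n.
Proof.
elim: n => [|n IH]; first by rewrite !expr0 Normc.normc1.
by rewrite !exprS Normc.normcM IH.
Qed.

Lemma Re_normc_le z : `|Re z| <= normc z.
Proof.
rewrite -(@ler_pXn2r _ 2) ?nnegrE ?normc_ge0 //.
by rewrite sqr_normc_Re_Im real_normK ?num_real // lerDl sqr_ge0.
Qed.

Lemma Re_le_normc z : Re z <= normc z.
Proof. exact: le_trans (ler_norm _) (Re_normc_le z). Qed.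

Lemma Re_ge_normc z : - normc z <= Re z.
Proof. by have := Re_normc_le z; rewrite ler_norml => /andP[]. Qed.

Lemma normcB z w : normc (z - w) <= normc z + normc w.
Proof. by apply: le_trans (normcD _ _) _; rewrite (normcN w). Qed.

Lemma complexP z w : Re z = Re w -> Im z = Im w -> z = w.
Proof. by move=> h1 h2; apply/eqP; rewrite eq_complex h1 h2 !eqxx. Qed.

End ComplexModulus.

(* Completeness is stated for the squared norm, and [ip] is linear in its first
   argument. *)
Structure hilbert (R : realType) := Hilbert {
  carrier :> lmodType R[i];
  ip : carrier -> carrier -> R[i];
  _ : forall x y z, ip (x + y) z = ip x z + ip y z;
  _ : forall (a : R[i]) x y, ip (a *: x) y = a * ip x y;
  _ : forall x y, ip x y = ((ip y x)^*)%C;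
  _ : forall x, 0 <= Re (ip x x);
  _ : forall x, Re (ip x x) = 0 -> x = 0;
  _ : forall u : nat -> carrier,
    (forall e : R, 0 < e -> exists N : nat, forall m n : nat,
       (N <= m)%N -> (N <= n)%N -> Re (ip (u m - u n) (u m - u n)) <= e) ->
    exists x, forall e : R, 0 < e -> exists N : nat, forall n : nat,
       (N <= n)%N -> Re (ip (u n - x) (u n - x)) <= e }.

Definition nsq (R : realType) (H : hilbert R) (x : H) : R := Re (ip x x).
Definition hn (R : realType) (H : hilbert R) (x : H) : R := Num.sqrt (nsq x).
Definition tends (R : realType) (H : hilbert R) (u : nat -> H) (x : H) : Prop :=
  forall e : R, 0 < e -> exists N : nat, forall n : nat,
    (N <= n)%N -> nsq (u n - x) <= e.

Section HilbertBasics.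
Variables (R : realType) (H : hilbert R).
Implicit Types (x y z : H) (a b : R[i]).

Lemma ipDl x y z : ip (x + y) z = ip x z + ip y z.
Proof. by case: H x y z. Qed.
Lemma ipZl a x y : ip (a *: x) y = a * ip x y.
Proof. by case: H x y. Qed.
Lemma ipC x y : ip x y = ((ip y x)^*)%C.
Proof. by case: H x y. Qed.
Lemma nsq_ge0 x : 0 <= nsq x.
Proof. by rewrite /nsq; case: H x. Qed.
Lemma nsq0P x : nsq x = 0 -> x = 0.
Proof. by rewrite /nsq; case: H x. Qed.
Lemma ip_complete (u : nat -> H) :
  (forall e : R, 0 < e -> exists N : nat, forall m n : nat,
       (N <= m)%N -> (N <= n)%N -> nsq (u m - u n) <= e) ->
  exists x, tends u x.
Proof. by rewrite /nsq /tends; case: H u. Qed.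

Lemma ipDr x y z : ip x (y + z) = ip x y + ip x z.
Proof. by rewrite ipC ipDl conjcD -!ipC. Qed.
Lemma ipZr a x y : ip x (a *: y) = (a^*)%C * ip x y.
Proof. by rewrite ipC ipZl conjcM -ipC. Qed.
Lemma ip0l x : ip 0 x = 0.
Proof. by rewrite -(scale0r x) ipZl mul0r. Qed.
Lemma ip0r x : ip x 0 = 0.
Proof. by rewrite ipC ip0l conjc0. Qed.
Lemma ipNl x y : ip (- x) y = - ip x y.
Proof. by rewrite -scaleN1r ipZl mulN1r. Qed.
Lemma ipNr x y : ip x (- y) = - ip x y.
Proof. by rewrite ipC ipNl rmorphN /= -ipC. Qed.
Lemma ipBl x y z : ip (x - y) z = ip x z - ip y z.
Proof. by rewrite ipDl ipNl. Qed.
Lemma ipBr x y z : ip x (y - z) = ip x y - ip x z.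
Proof. by rewrite ipDr ipNr. Qed.
Lemma ip_suml (I : Type) (r : seq I) (P : pred I) (F : I -> H) y :
  ip (\sum_(i <- r | P i) F i) y = \sum_(i <- r | P i) ip (F i) y.
Proof. exact: (big_morph (fun z => ip z y) (fun z w => ipDl z w y) (ip0l y)). Qed.
Lemma ip_sumr (I : Type) (r : seq I) (P : pred I) (F : I -> H) y :
  ip y (\sum_(i <- r | P i) F i) = \sum_(i <- r | P i) ip y (F i).
Proof. exact: (big_morph (ip y) (ipDr y) (ip0r y)). Qed.
Lemma ip_eq0C x y : ip x y = 0 -> ip y x = 0.
Proof. by move=> h; rewrite ipC h conjc0. Qed.

Lemma ipxx x : ip x x = (nsq x)%:C%C.
Proof.
have := ipC x x; rewrite /nsq; case: (ip x x) => a b [] hb.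
by congr Complex; lra.
Qed.

Lemma nsq0 : nsq (0 : H) = 0. Proof. by rewrite /nsq ip0l. Qed.
Lemma nsq_gt0 x : x != 0 -> 0 < nsq x.
Proof.
by move=> nz; rewrite lt_def nsq_ge0 andbT; apply: contra nz => /eqP/nsq0P ->.
Qed.
Lemma nsqD x y : nsq (x + y) = nsq x + nsq y + 2 * Re (ip x y).
Proof.
rewrite /nsq ipDl !ipDr !ReD (ipC y x) ReJ; ring.
Qed.
Lemma nsqN x : nsq (- x) = nsq x.
Proof. by rewrite /nsq ipNl ipNr opprK. Qed.
Lemma nsqB x y : nsq (x - y) = nsq x + nsq y - 2 * Re (ip x y).
Proof. by rewrite nsqD nsqN ipNr ReN; ring. Qed.
Lemma nsqBC x y : nsq (x - y) = nsq (y - x).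
Proof. by rewrite -nsqN opprB. Qed.
Lemma nsqZ a x : nsq (a *: x) = normc a ^+ 2 * nsq x.
Proof. by rewrite /nsq ipZl ipZr mulrA mulcJ ReZ. Qed.
Lemma nsq_pyth x y : ip x y = 0 -> nsq (x + y) = nsq x + nsq y.
Proof. by move=> h; rewrite nsqD h mulr0 addr0. Qed.
Lemma hn_ge0 x : 0 <= hn x. Proof. exact: sqrtr_ge0. Qed.
Lemma hn2 x : hn x ^+ 2 = nsq x.
Proof. by rewrite sqr_sqrtr // nsq_ge0. Qed.
Lemma hn0P x : hn x = 0 -> x = 0.
Proof. by move=> h; apply: nsq0P; rewrite -hn2 h expr0n. Qed.
Lemma hn_eq0 x : (hn x == 0) = (x == 0).
Proof. by apply/eqP/eqP => [/hn0P//|->]; rewrite /hn nsq0 sqrtr0. Qed.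
Lemma hn0 : hn (0 : H) = 0. Proof. by apply/eqP; rewrite hn_eq0. Qed.
Lemma hnN x : hn (- x) = hn x. Proof. by rewrite /hn nsqN. Qed.
Lemma hnZ a x : hn (a *: x) = normc a * hn x.
Proof.
by rewrite /hn nsqZ sqrtrM ?sqr_ge0 // sqrtr_sqr ger0_norm // normc_ge0.
Qed.

Lemma cauchy_schwarz_sqr x y : normc (ip x y) ^+ 2 <= nsq x * nsq y.
Proof.
have [->|nz] := eqVneq y 0.
  by rewrite ip0r Normc.normc0 expr0n /= nsq0 mulr0.
have y0 := nsq_gt0 nz.
have ynz : nsq y != 0 by rewrite gt_eqF.
pose a := ((nsq y)^-1)%:C%C * ip x y.
have := nsq_ge0 (x - a *: y).
rewrite nsqB nsqZ ipZr /a Normc.normcM normcR conjcM conjc_real -mulrA ReZ.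
rewrite [X in Re X]mulrC mulcJ /= ger0_norm ?invr_ge0 ?nsq_ge0 //.
set p := normc _; move=> h.
suff : p ^+ 2 / nsq y <= nsq x by rewrite ler_pdivrMr.
suff -> : p ^+ 2 / nsq y =
  - ((((nsq y)^-1 * p) ^+ 2 * nsq y) - 2 * ((nsq y)^-1 * p ^+ 2)) by lra.
by field.
Qed.

Lemma cauchy_schwarz x y : normc (ip x y) <= hn x * hn y.
Proof.
rewrite -(@ler_pXn2r _ 2) ?nnegrE ?normc_ge0 ?mulr_ge0 ?hn_ge0 //.
by rewrite exprMn !hn2 cauchy_schwarz_sqr.
Qed.

Lemma hnD x y : hn (x + y) <= hn x + hn y.
Proof.
rewrite -(@ler_pXn2r _ 2) ?nnegrE ?addr_ge0 ?hn_ge0 //.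
rewrite hn2 nsqD sqrrD !hn2 addrAC lerD2r lerD2l.
rewrite -[leRHS]mulr_natl ler_wpM2l //.
exact: le_trans (Re_le_normc _) (cauchy_schwarz _ _).
Qed.

Lemma hnB x y : hn (x - y) <= hn x + hn y.
Proof. by apply: le_trans (hnD _ _) _; rewrite hnN. Qed.

Lemma hn_le (x : H) (e : R) : 0 <= e -> (hn x <= e) = (nsq x <= e ^+ 2).
Proof.
by move=> e0; rewrite -(@ler_pXn2r _ 2) ?nnegrE ?hn_ge0 // hn2.
Qed.

Lemma tendsP (u : nat -> H) x : tends u x <->
  forall e : R, 0 < e -> exists N : nat, forall n : nat,
    (N <= n)%N -> hn (u n - x) <= e.
Proof.
split=> h e e0.
  have [N hN] := h (e ^+ 2) (exprn_gt0 _ e0); exists N => n /hN.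
  by rewrite -hn_le // ltW.
have [N hN] := h (Num.sqrt e) (ltac:(by rewrite sqrtr_gt0)); exists N => n /hN.
by rewrite hn_le ?sqrtr_ge0 // sqr_sqrtr // ltW.
Qed.

Lemma tends_unique (u : nat -> H) x y : tends u x -> tends u y -> x = y.
Proof.
move=> /tendsP hx /tendsP hy; apply/eqP; rewrite -subr_eq0 -hn_eq0.
apply/eqP/le_anti; rewrite hn_ge0 andbT; apply/ler_addgt0Pr => e e0.
rewrite add0r; have e2 : 0 < e / 2 by lra.
have [N1 h1] := hx _ e2; have [N2 h2] := hy _ e2.
have := h1 (maxn N1 N2) (leq_maxl _ _); have := h2 (maxn N1 N2) (leq_maxr _ _).
set v := u _ => k2 k1.
have -> : x - y = (v - y) - (v - x) by rewrite opprB [RHS]addrC addrA subrK.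
by apply: le_trans (hnB _ _) _; lra.
Qed.

End HilbertBasics.

(** * Bounded operators, orthogonal complements, coercive operators *)

Definition bop (R : realType) (H : hilbert R) (f : H -> H) : Prop :=
  linear f /\ exists2 K : R, 0 < K & forall x, hn (f x) <= K * hn x.

Definition binv (R : realType) (H : hilbert R) (f : H -> H) : Prop :=
  exists S : H -> H, [/\ bop S, cancel f S & cancel S f].

Section HilbertOperators.
Variables (R : realType) (H : hilbert R).
Implicit Types (x y z : H) (a b : R[i]) (f g : H -> H).

Lemma linD f : linear f -> {morph f : x y / x + y}.
Proof. by move=> lf x y; rewrite -[x]scale1r lf !scale1r. Qed.
Lemma lin0 f : linear f -> f 0 = 0.
Proof. by move=> lf; have := lf (-1) 0 0; rewrite scaler0 addr0 scaleN1r addNr. Qed.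
Lemma linZ f : linear f -> forall a x, f (a *: x) = a *: f x.
Proof. by move=> lf a x; rewrite -[a *: x]addr0 lf lin0 // addr0. Qed.
Lemma linN f : linear f -> {morph f : x / - x}.
Proof. by move=> lf x; rewrite -scaleN1r linZ // scaleN1r. Qed.
Lemma linB f : linear f -> {morph f : x y / x - y}.
Proof. by move=> lf x y; rewrite linD // linN. Qed.
Lemma lin_sum f : linear f -> forall (I : Type) (r : seq I) (P : pred I) (F : I -> H),
  f (\sum_(i <- r | P i) F i) = \sum_(i <- r | P i) f (F i).
Proof. by move=> lf I r P F; exact: (big_morph f (linD lf) (lin0 lf)). Qed.

Lemma bop_comp f g : bop f -> bop g -> bop (f \o g).
Proof.
move=> [lf [K K0 hK]] [lg [L L0 hL]]; split; first by move=> a x y /=; rewrite lg lf.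
exists (K * L); first exact: mulr_gt0.
move=> x /=; apply: le_trans (hK _) _.
by rewrite -mulrA ler_wpM2l // ltW.
Qed.

Lemma bopD f g : bop f -> bop g -> bop (fun x => f x + g x).
Proof.
move=> [lf [K K0 hK]] [lg [L L0 hL]]; split.
  by move=> a x y; rewrite lf lg scalerDr addrACA.
exists (K + L); first exact: addr_gt0.
move=> x /=; apply: le_trans (hnD _ _) _.
by rewrite mulrDl lerD.
Qed.

Lemma bopZ c f : bop f -> bop (fun x => c *: f x).
Proof.
move=> [lf [K K0 hK]]; split.
  by move=> a x y; rewrite lf scalerDr !scalerA mulrC.
exists ((normc c + 1) * K).
  by rewrite mulr_gt0 // ltr_wpDl // normc_ge0.
move=> x /=; rewrite hnZ -mulrA ler_pM ?normc_ge0 ?hn_ge0 //.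
by rewrite lerDl.
Qed.

Lemma bop_id : @bop R H (fun x => x).
Proof. by split=> //; exists 1 => // x; rewrite mul1r. Qed.

Lemma bop0 : @bop R H (fun _ => 0).
Proof.
split=> [a x y|]; first by rewrite scaler0 addr0.
by exists 1 => // x; rewrite hn0 mul1r hn_ge0.
Qed.

Lemma bop_sum (I : Type) (r : seq I) (F : I -> H -> H) :
  (forall i, bop (F i)) -> bop (fun x => \sum_(i <- r) F i x).
Proof.
move=> bF; elim: r => [|i r IH].
  by rewrite (_ : (fun _ => _) = (fun _ => 0)) ?funeqE => [|x]; [exact: bop0|rewrite big_nil].
rewrite (_ : (fun _ => _) = (fun x => F i x + \sum_(j <- r) F j x)).
  exact: bopD.
by rewrite funeqE => x; rewrite big_cons.
Qed.

Lemma bop_iter f n : bop f -> bop (iter n f).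
Proof.
move=> bf; elim: n => [|n IH]; first exact: bop_id.
exact: (bop_comp bf IH).
Qed.

Lemma bop_ip (y v : H) : bop (fun x => ip x y *: v).
Proof.
split=> [a x z|]; first by rewrite ipDl ipZl scalerDl scalerA.
exists (hn y * hn v + 1); first by rewrite ltr_wpDl // mulr_ge0 // hn_ge0.
move=> x; rewrite hnZ; apply: (@le_trans _ _ ((hn x * hn y) * hn v)).
  by rewrite ler_wpM2r ?hn_ge0 ?cauchy_schwarz.
by rewrite mulrDl mul1r -mulrA mulrC lerDl hn_ge0.
Qed.

Lemma tends_bop f (u : nat -> H) x : bop f -> tends u x -> tends (f \o u) (f x).
Proof.
move=> [lf [K K0 hK]] /tendsP h; apply/tendsP => e e0.
have [N hN] := h (e / K) (divr_gt0 e0 K0); exists N => n /hN le.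
rewrite /= -linB //; apply: le_trans (hK _) _.
by rewrite mulrC -ler_pdivlMr.
Qed.

Lemma tendsD (u v : nat -> H) x y :
  tends u x -> tends v y -> tends (fun n => u n + v n) (x + y).
Proof.
move=> /tendsP hu /tendsP hv; apply/tendsP => e e0; have e2 : 0 < e / 2 by lra.
have [N hN] := hu _ e2; have [M hM] := hv _ e2; exists (maxn N M) => n.
rewrite geq_max => /andP[/hN h1 /hM h2].
rewrite opprD addrACA; apply: le_trans (hnD _ _) _; lra.
Qed.

Lemma tends_cst x : tends (fun=> x) x.
Proof. by move=> e e0; exists 0%N => n _; rewrite subrr nsq0 ltW. Qed.

Lemma tendsN (u : nat -> H) x : tends u x -> tends (fun n => - u n) (- x).
Proof.
by move=> h e /h [N hN]; exists N => n /hN; rewrite -opprD nsqN.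
Qed.

Lemma tends_shift m (u : nat -> H) x : tends u x -> tends (fun n => u (n + m)%N) x.
Proof.
by move=> h e /h[N hN]; exists N => n hn; apply: hN; rewrite (leq_trans hn) // leq_addr.
Qed.

Lemma ip_lim (u v : nat -> H) x y a : tends u x -> tends v y ->
  (forall e : R, 0 < e -> exists N : nat, forall n, (N <= n)%N ->
     normc (ip (u n) (v n) - a) <= e) ->
  ip x y = a.
Proof.
move=> /tendsP hu /tendsP hv ha; apply/eqP; rewrite -subr_eq0 -normc_eq0.
apply/eqP/le_anti; rewrite normc_ge0 andbT; apply/ler_addgt0Pr => e e0.
rewrite add0r.
have hx := hn_ge0 x; have hy := hn_ge0 y.
(* The error splits into the given one and the three terms of the expansion of the product, bounded
   by [n1], [n1 * hn y], [hn x * n1] and [n1 * 1]; their sum is [n1 * t]. *)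
pose t := hn x + hn y + 2; have t0 : 0 < t by rewrite /t; lra.
pose n1 := Num.min 1 (e / t).
have n10 : 0 < n1 by rewrite lt_min ltr01 divr_gt0.
have n11 : n1 <= 1 by rewrite ge_min lexx.
have n1e : n1 * t <= e by rewrite -ler_pdivlMr // ge_min lexx orbT.
have [N1 h1] := hu _ n10; have [N2 h2] := hv _ n10; have [N3 h3] := ha _ n10.
pose N := maxn N1 (maxn N2 N3).
have {}h1 := h1 N (leq_maxl _ _).
have {}h2 : hn (v N - y) <= n1.
  by apply: h2; rewrite /N leq_max leq_max leqnn orbT.
have {}h3 : normc (ip (u N) (v N) - a) <= n1.
  by apply: h3; rewrite /N leq_max leq_max leqnn !orbT.
have -> : ip x y - a = (ip (u N) (v N) - a) - (ip (u N - x) y + ip x (v N - y)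
     + ip (u N - x) (v N - y)).
  by rewrite !ipBl !ipBr; ring.
apply: le_trans (normcB _ _) _.
apply: (le_trans (lerD h3 (normcD _ _))).
have k1 : normc (ip (u N - x) y + ip x (v N - y)) <= n1 * hn y + hn x * n1.
  apply: le_trans (normcD _ _) _; apply: lerD.
    by apply: le_trans (cauchy_schwarz _ _) _; rewrite ler_wpM2r.
  by apply: le_trans (cauchy_schwarz _ _) _; rewrite ler_wpM2l.
have k2 : normc (ip (u N - x) (v N - y)) <= n1 * 1.
  apply: le_trans (cauchy_schwarz _ _) _; apply: ler_pM; rewrite ?hn_ge0 //.
  exact: le_trans h2 n11.
move: n1e; rewrite /t; move: k1 k2; lra.
Qed.

Lemma ip_lim0 (u : nat -> H) x y :
  tends u x -> (forall n, ip (u n) y = 0) -> ip x y = 0.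
Proof.
move=> hu h; apply: (ip_lim hu (tends_cst y)) => e e0; exists 0%N => n _.
by rewrite h subrr Normc.normc0 ltW.
Qed.

Lemma nsq_sub_proj x y : y != 0 ->
  nsq (x - (ip x y / (nsq y)%:C%C) *: y) = nsq x - normc (ip x y) ^+ 2 / nsq y.
Proof.
move=> nz; have ynz : nsq y != 0 by rewrite gt_eqF // nsq_gt0.
pose a := ((nsq y)^-1)%:C%C * ip x y.
have -> : ip x y / (nsq y)%:C%C = a by rewrite /a mulrC -fmorphV.
rewrite nsqB nsqZ ipZr /a Normc.normcM normcR conjcM conjc_real -mulrA ReZ.
rewrite [X in Re X]mulrC mulcJ /= ger0_norm ?invr_ge0 ?nsq_ge0 //.
by field.
Qed.

Lemma parallelogram x y : nsq (x + y) + nsq (x - y) = 2 * nsq x + 2 * nsq y.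
Proof. by rewrite nsqD nsqB; ring. Qed.

(* A minimizing sequence for the distance from [x] to [M] is Cauchy by the
   parallelogram law. *)
Lemma orth_exists (M : H -> Prop) x :
  M 0 -> (forall a y z, M y -> M z -> M (a *: y + z)) ->
  (forall u y, (forall n : nat, M (u n)) -> tends u y -> M y) ->
  ~ M x -> exists2 y : H, y != 0 & forall m, M m -> ip m y = 0.
Proof.
move=> M0 Ml Mc Mx.
pose D := [set nsq (x - m) | m in M]%classic.
have D0 : has_inf D.
  by split; [exists (nsq (x - 0)), 0|exists 0 => _ [m _ <-]; exact: nsq_ge0].
pose d := inf D.
have dle m : M m -> d <= nsq (x - m).
  by move=> Mm; apply: (ge_inf D0.2); exists m.
have ex n : exists m, M m /\ nsq (x - m) <= d + n.+1%:R^-1.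
  have [_ [m Mm <-] lt] := @inf_adherent _ D n.+1%:R^-1 (ltac:(by rewrite invr_gt0)) D0.
  by exists m; split=> //; rewrite ltW.
have [u hu] := choice ex.
have Mu n : M (u n) by have [] := hu n.
have small (e : R) : 0 < e -> exists N : nat, forall n : nat, (N <= n)%N -> n.+1%:R^-1 <= e.
  move=> e0; exists (Num.truncn e^-1) => n hn.
  rewrite -[e]invrK lef_pV2 ?posrE ?invr_gt0 //.
  apply: le_trans (ltW (truncnS_gt _)) _.
  by rewrite ler_nat ltnS.
have [y hy] : exists y, tends u y.
  apply: ip_complete => e e0; have [N hN] := small (e / 4) (ltac:(lra)).
  exists N => m n /hN hm /hN hk.
  have [_ h1] := hu m; have [_ h2] := hu n.
  have h3 := parallelogram (x - u n) (x - u m).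
  have e1 : x - u n - (x - u m) = u m - u n by rewrite opprB [x - _ + _]addrC addrA subrK.
  have e2 : x - u n + (x - u m) = 2%:R%:C%C *: (x - (2^-1)%:C%C *: (u n + u m)).
    rewrite scalerBr scalerA -rmorphM /= divff ?pnatr_eq0 // scale1r.
    by rewrite rmorph_nat scaler_nat mulr2n opprD addrACA.
  move: h3; rewrite e1 e2 nsqZ normcR ger0_norm // => h3.
  have Mm : M ((2^-1)%:C%C *: (u n + u m)).
    by rewrite -[_ *: _]addr0; apply: (Ml) => //; rewrite -[u n]scale1r; exact: Ml.
  move: (dle _ Mm) h1 h2 h3 hm hk.
  move: (nsq (x - _ *: _)) (nsq (u m - u n)) (m.+1%:R^-1) (n.+1%:R^-1) => A B C1 C2.
  lra.
have My : M y by apply: (Mc u).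
exists (x - y).
  by apply/eqP => /subr0_eq xy; apply: Mx; rewrite xy.
move=> m Mm; apply: ip_eq0C.
have [->|mnz] := eqVneq m 0; first by rewrite ip0r.
have hxu : tends (fun n => x - u n) (x - y).
  by apply: tendsD; [exact: tends_cst|exact: tendsN].
apply: (ip_lim hxu (tends_cst m)) => e e0.
have m0 := nsq_gt0 mnz.
have [N hN] := small (e ^+ 2 / nsq m) (ltac:(by rewrite divr_gt0 // exprn_gt0)).
exists N => n /hN le; rewrite subr0.
rewrite -(@ler_pXn2r _ 2) ?nnegrE ?normc_ge0 ?(ltW e0) //.
have := nsq_sub_proj (x - u n) mnz.
set b := _ / _ => h1; have h2 : d <= nsq (x - u n - b *: m).
  rewrite -addrA -opprD; apply: dle; rewrite addrC; exact: Ml.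
have [_ h3] := hu n.
have h4 : normc (ip (x - u n) m) ^+ 2 / nsq m <= e ^+ 2 / nsq m.
  apply: le_trans le; move: h1 h2 h3.
  move: (nsq (x - u n - _)) (nsq (x - u n)) (n.+1%:R^-1) (_ / _) => A B C1 C2.
  lra.
have mi : 0 < (nsq m)^-1 by rewrite invr_gt0.
by move: h4; rewrite (ler_pM2r mi).
Qed.

Lemma riesz (phi : H -> R[i]) (K : R) :
  (forall a x y, phi (a *: x + y) = a * phi x + phi y) ->
  (forall x, normc (phi x) <= K * hn x) ->
  exists y, forall x, phi x = ip x y.
Proof.
move=> lphi bphi.
have phi0 : phi 0 = 0.
  by have := lphi (-1) 0 0; rewrite scaler0 addr0 mulN1r addNr.
have [all0|] := pselect (forall x, phi x = 0).
  by exists 0 => x; rewrite ip0r.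
move=> /existsNP[x0 hx0].
have [] := @orth_exists (fun x => phi x = 0) x0 _ _ _ hx0.
- exact: phi0.
- by move=> a y z hy hz; rewrite lphi hy hz mulr0 addr0.
- move=> u y hu /tendsP tu; apply/eqP; rewrite -normc_eq0; apply/eqP/le_anti.
  rewrite normc_ge0 andbT; apply/ler_addgt0Pr => e e0; rewrite add0r.
  have K1 : 0 < `|K| + 1 by rewrite ltr_wpDl.
  have [N hN] := tu _ (divr_gt0 e0 K1).
  have -> : phi y = phi (-1 *: (u N - y) + u N).
    by rewrite scaleN1r opprB subrK.
  rewrite lphi hu addr0 mulN1r (normcN (phi _)).
  apply: le_trans (bphi _) _; apply: (@le_trans _ _ ((`|K| + 1) * hn (u N - y))).
    rewrite ler_wpM2r ?hn_ge0 //; apply: le_trans (ler_norm _) _; lra.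
  by rewrite mulrC -ler_pdivlMr // hN.
move=> y ynz hy.
have ny : (nsq y)%:C%C != 0 :> R[i].
  by rewrite eq_complex /= eqxx andbT gt_eqF // nsq_gt0.
have py : phi y != 0.
  apply/eqP => /hy /eqP; rewrite ipxx; exact/negP.
exists ((((phi y)^*)%C / (nsq y)%:C%C) *: y) => x.
rewrite ipZr conjcM conjcK -fmorphV conjc_real fmorphV.
have : ip (- (phi x / phi y) *: y + x) y = 0.
  by apply: hy; rewrite lphi mulNr divfK // addNr.
rewrite ipDl ipZl ipxx => /eqP; rewrite addr_eq0 mulNr eqr_opp => /eqP <-.
by field; rewrite py ny.
Qed.

Lemma adjoint_exists f y : bop f -> exists z, forall x, ip (f x) y = ip x z.
Proof.
move=> [lf [K K0 hK]]; apply: (@riesz _ (K * hn y)) => [a x z|x].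
  by rewrite lf ipDl ipZl.
apply: le_trans (cauchy_schwarz _ _) _.
by rewrite mulrAC ler_wpM2r ?hn_ge0.
Qed.

(** The bound makes [f] bounded below, hence injective with closed range, and a vector orthogonal to
    the range vanishes by the bound at that vector. Bounding the modulus covers both coercive real
    parts and [normc_singular]. *)
Lemma lax_milgram f (e : R) : bop f -> 0 < e ->
  (forall x, e * nsq x <= normc (ip (f x) x)) -> binv f.
Proof.
move=> bf e0 cf; have [lf [K K0 hK]] := bf.
have low x : e * hn x <= hn (f x).
  have [->|nz] := eqVneq x 0; first by rewrite hn0 mulr0 hn_ge0.
  have hx : 0 < hn x by rewrite lt_def hn_ge0 hn_eq0 nz.
  have := le_trans (cf x) (cauchy_schwarz _ _).
  by rewrite -hn2 expr2 mulrA ler_pM2r.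
have inj : injective f.
  move=> x y /eqP; rewrite -subr_eq0 -linB // => /eqP h.
  apply/eqP; rewrite -subr_eq0 -hn_eq0; apply/eqP/le_anti; rewrite hn_ge0 andbT.
  by have := low (x - y); rewrite h hn0 pmulr_rle0.
have surj y : exists x, f x = y.
  apply: contrapT => ny.
  have [] := @orth_exists (fun y => exists x, f x = y) y _ _ _ ny.
  - by exists 0; rewrite lin0.
  - by move=> a _ _ [u <-] [v <-]; exists (a *: u + v); rewrite lf.
  - move=> u z /choice[v hv] tu.
    have [w tw] : exists w, tends v w.
      apply: ip_complete => d d0.
      have [N hN] : exists N, forall n, (N <= n)%N -> hn (u n - z) <= e * Num.sqrt d / 2.
        move/tendsP: tu; apply; rewrite divr_gt0 ?mulr_gt0 ?sqrtr_gt0 //.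
      exists N => m n /hN hm /hN hn'.
      rewrite -[leRHS]sqr_sqrtr ?(ltW d0) // -hn_le ?sqrtr_ge0 //.
      rewrite -(ler_pM2l e0); apply: le_trans (low _) _.
      rewrite linB // !hv.
      have -> : u m - u n = (u m - z) - (u n - z) by rewrite opprB addrA subrK.
      apply: le_trans (hnB _ _) _; lra.
    exists w; apply: tends_unique tu.
    have -> : u = f \o v by apply/funext => n /=; rewrite hv.
    exact: tends_bop.
  move=> z znz hz.
  have := cf z; rewrite hz; last by exists z.
  by rewrite Normc.normc0 pmulr_rle0 // leNgt nsq_gt0.
have [S hS] := choice surj.
exists S; split=> //; last by move=> x; apply: inj; rewrite hS.
split; first by move=> a x y; apply: inj; rewrite lf !hS.
exists e^-1; first by rewrite invr_gt0.
by move=> x; rewrite -ler_pdivrMl ?invr_gt0 // invrK -{2}[x]hS.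
Qed.

End HilbertOperators.

(** * Orthonormal families, finite-rank perturbations, eigenvalues *)

Definition orthofamily (R : realType) (H : hilbert R) (n : nat) (e : nat -> H) : Prop :=
  forall i j, (i < n)%N -> (j < n)%N -> ip (e i) (e j) = (i == j)%:R.

Definition proj (R : realType) (H : hilbert R) (n : nat) (e : nat -> H) (x : H) : H :=
  \sum_(i < n) ip x (e i) *: e i.

Section FiniteRank.
Variables (R : realType) (H : hilbert R).
Implicit Types (x y z : H) (a b : R[i]) (f g : H -> H) (e v w : nat -> H).

Lemma ip_orthonormal_sum n e (c : nat -> R[i]) j : orthofamily n e -> (j < n)%N ->
  ip (\sum_(i < n) c i *: e i) (e j) = c j.
Proof.
move=> oe jn; rewrite ip_suml (bigD1 (Ordinal jn)) //= ipZl oe // eqxx mulr1.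
rewrite big1 ?addr0 // => i ij; rewrite ipZl oe //.
by move: ij; rewrite -val_eqE /= => /negbTE ->; rewrite mulr0.
Qed.

Lemma ip_sub_proj n e x j : orthofamily n e -> (j < n)%N ->
  ip (x - proj n e x) (e j) = 0.
Proof.
by move=> oe jn; rewrite ipBl (ip_orthonormal_sum (fun i => ip x (e i))) // subrr.
Qed.

Lemma nsq_orthonormal_sum n e (c : nat -> R[i]) : orthofamily n e ->
  nsq (\sum_(i < n) c i *: e i) = \sum_(i < n) normc (c i) ^+ 2.
Proof.
move=> oe; rewrite /nsq ip_sumr Re_sum; apply: eq_bigr => j _.
by rewrite ipZr ip_orthonormal_sum // mulrC mulcJ.
Qed.

Lemma bessel n e x : orthofamily n e ->
  \sum_(i < n) normc (ip x (e i)) ^+ 2 <= nsq x.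
Proof.
move=> oe; rewrite -(nsq_orthonormal_sum (fun i => ip x (e i)) oe).
rewrite -{2}(subrK (proj n e x) x) nsq_pyth ?lerDr ?nsq_ge0 //.
rewrite {2}/proj ip_sumr big1 // => i _.
by rewrite ipZr ip_sub_proj // mulr0.
Qed.

Lemma orthonormal_extend n e x : orthofamily n e ->
  (forall i, (i < n)%N -> ip x (e i) = 0) -> x != 0 ->
  orthofamily n.+1 (fun i => if i == n then ((hn x)^-1)%:C%C *: x else e i).
Proof.
move=> oe ox xnz i j; rewrite !ltnS (leq_eqVlt i) (leq_eqVlt j).
have hnz : hn x != 0 by rewrite hn_eq0.
have ox' k : (k < n)%N -> ip (e k) x = 0 by move=> /ox /ip_eq0C.
case: (eqVneq i n) => [->|ni]; case: (eqVneq j n) => [->|nj] //=.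
- move=> _ _; rewrite ipZl ipZr conjc_real ipxx.
  rewrite -2!(rmorphM (real_complex R)) /= -hn2.
  suff -> : (hn x)^-1 * ((hn x)^-1 * hn x ^+ 2) = 1 by [].
  by field.
- by move=> _ jn; rewrite ipZl ox // mulr0.
- by move=> il _; rewrite ipZr ox' // mulr0 (negbTE ni).
- exact: oe.
Qed.

Lemma gram_schmidt (F : seq H) : exists n e, orthofamily n e /\
  forall x, (forall i, (i < n)%N -> ip x (e i) = 0) -> forall y, y \in F -> ip x y = 0.
Proof.
elim: F => [|y F [n [e [oe he]]]]; first by exists 0%N, (fun=> 0); split.
pose g := y - proj n e y.
have yE : y = g + proj n e y by rewrite subrK.
have pE x : (forall i, (i < n)%N -> ip x (e i) = 0) -> ip x (proj n e y) = 0.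
  move=> hx; rewrite ip_sumr big1 // => i _; rewrite ipZr hx // mulr0 //.
have [g0|gnz] := eqVneq g 0.
  exists n, e; split=> // x hx z; rewrite inE => /orP[/eqP ->|]; last exact: he.
  by rewrite yE g0 add0r pE.
have og i : (i < n)%N -> ip g (e i) = 0 by exact: ip_sub_proj.
exists n.+1; eexists; split; first exact: (orthonormal_extend oe og gnz).
move=> x hx; have hx' i : (i < n)%N -> ip x (e i) = 0.
  by move=> ni; have := hx i (ltnW ni); rewrite ltn_eqF.
move=> z; rewrite inE => /orP[/eqP ->|]; last exact: he.
have := hx n (leqnn _); rewrite eqxx ipZr conjc_real => /eqP; rewrite mulf_eq0.
rewrite eq_complex /= eqxx andbT invr_eq0 hn_eq0 (negbTE gnz) /= => /eqP xg.
by rewrite yE ipDr xg pE // addr0.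
Qed.

(* If [C] is invertible, [C x - sum_i <x, e_i> v_i = y] reduces to a linear
   system for the numbers [<x, e_i>]. *)
Lemma fredholm (C f : H -> H) n e v : binv C -> bop C ->
  (forall x, f x = C x - \sum_(i < n) ip x (e i) *: v i) ->
  (forall x, f x = 0 -> x = 0) -> binv f.
Proof.
move=> [S [bS CS SC]] bC fE f0; have [lC _] := bC; have [lS _] := bS.
pose G := \matrix_(i < n, j < n) ip (S (v i)) (e j).
pose M := 1%:M - G.
have bf : bop f.
  rewrite (_ : f = fun x => C x + -1 *: \sum_(i < n) ip x (e i) *: v i).
    by apply: bopD => //; apply/bopZ/bop_sum => i; exact: bop_ip.
  by apply/funext => x; rewrite fE scaleN1r.
have [lf _] := bf.
have finj : injective f.
  move=> x y /eqP; rewrite -subr_eq0 -linB // => /eqP /f0 /eqP.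
  by rewrite subr_eq0 => /eqP.
have ipG (al : 'rV[R[i]]_n) (j : 'I_n) :
    ip (\sum_(i < n) al 0 i *: S (v i)) (e j) = (al *m G) 0 j.
  by rewrite ip_suml mxE; apply: eq_bigr => i _; rewrite ipZl mxE.
have CG (al : 'rV[R[i]]_n) :
    C (\sum_(i < n) al 0 i *: S (v i)) = \sum_(i < n) al 0 i *: v i.
  by rewrite (lin_sum lC); apply: eq_bigr => i _; rewrite linZ // SC.
(* If [al *m M = 0], the combination of the [S (v i)] with coefficients [al] has [al] as its list of
   products with the [e i], so [f] kills it; it is zero, and with it [al]. *)
have Mu : M \in unitmx.
  rewrite -row_free_unit -kermx_eq0; apply/eqP/row_matrixP => i.
  rewrite row0; set al := row i _.
  have alM : al *m M = 0 by rewrite -row_mul mulmx_ker row0.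
  have alG : al *m G = al.
    by move/eqP: alM; rewrite mulmxBr mulmx1 subr_eq0 => /eqP <-.
  have x0 : \sum_(i < n) al 0 i *: S (v i) = 0.
    apply: f0; rewrite fE CG -sumrB big1 // => j _.
    by rewrite ipG alG subrr.
  by apply/rowP => j; rewrite -alG -ipG x0 ip0l mxE.
pose N := invmx M.
pose al y : 'rV[R[i]]_n := (\row_j ip (S y) (e j)) *m N.
pose S' y := S y + \sum_(i < n) al y 0 i *: S (v i).
have fS' y : f (S' y) = y.
  rewrite fE (linD lC) CG SC -addrA -sumrB big1 ?addr0 // => i _.
  rewrite /S' ipDl ipG -scalerBl.
  have := mulmxKV Mu (\row_j ip (S y) (e j)).
  rewrite -/N -/(al y) mulmxBr mulmx1 => /rowP /(_ i).
  rewrite mxE [X in _ + X]mxE [RHS]mxE => <-.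
  by rewrite subrK subrr scale0r.
exists S'; split=> //; last by move=> x; apply: finj; rewrite fS'.
rewrite (_ : S' = fun y => S y + \sum_(i < n)
    \sum_(j < n) N j i *: (ip (S y) (e j) *: S (v i))).
  apply: bopD => //; apply: bop_sum => i; apply: bop_sum => j; apply: bopZ.
  exact: (bop_comp (bop_ip (e j) (S (v i))) bS).
apply/funext => y; congr (_ + _); apply: eq_bigr => i _.
rewrite mxE scaler_suml; apply: eq_bigr => j _.
by rewrite mxE scalerA mulrC.
Qed.

(** The product of the operators [f - mu i]. It kills the span of the first [n] eigenvectors but no
    eigenvector of a further eigenvalue, which is how [triangularize] sees that the Gram-Schmidt
    remainder is nonzero. *)
Fixpoint annihilator f (mu : nat -> R[i]) n x : H :=
  if n is m.+1 then f (annihilator f mu m x) - mu m *: annihilator f mu m x else x.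

Lemma annihilator_lin f mu n : linear f -> linear (annihilator f mu n).
Proof.
move=> lf; elim: n => [//|n IH] a x y /=.
by rewrite IH lf scalerDr scalerBr !scalerA [a * _]mulrC opprD addrACA.
Qed.

Lemma annihilator_eigen f mu n a x : linear f -> f x = a *: x ->
  annihilator f mu n x = (\prod_(i < n) (a - mu i)) *: x.
Proof.
move=> lf fx; elim: n => [|n IH /=]; first by rewrite big_ord0 scale1r.
rewrite IH linZ // fx big_ord_recr /= !scalerA -scalerBl; congr (_ *: _); ring.
Qed.

(* Gram-Schmidt applied to eigenvectors of distinct eigenvalues triangularizes
   [f] with the eigenvalues on the diagonal. *)
Lemma triangularize f mu v n : linear f ->
  (forall i j, (i < n)%N -> (j < n)%N -> mu i = mu j -> i = j) ->
  (forall i, (i < n)%N -> v i != 0 /\ f (v i) = mu i *: v i) ->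
  exists w, orthofamily n w /\ forall i, (i < n)%N -> ip (f (w i)) (w i) = mu i.
Proof.
move=> lf inj eig.
(* The induction also carries the invariance of the span of the [w i] under [f], expressed through
   the vectors orthogonal to it, and the fact that the annihilator kills this span. *)
suff [w [ow [hw _]]] : exists w, orthofamily n w /\
    (forall i, (i < n)%N -> ip (f (w i)) (w i) = mu i) /\
    (forall y, (forall i, (i < n)%N -> ip (w i) y = 0) ->
       forall i, (i < n)%N -> ip (f (w i)) y = 0) /\
    (forall i, (i < n)%N -> annihilator f mu n (w i) = 0) by exists w.
elim: n inj eig => [_ _|n IH inj eig]; first by exists (fun=> 0); split.
have [i j hi hj|i hi|w [ow [dw [tw aw]]]] := IH.
- by apply: inj; apply: ltnW.
- by apply: eig; apply: ltnW.
have la m : linear (annihilator f mu m) by exact: annihilator_lin.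
have [vnz fv] := eig n (leqnn _).
pose g := v n - proj n w (v n).
have vE : v n = g + proj n w (v n) by rewrite subrK.
have ap : annihilator f mu n (proj n w (v n)) = 0.
  by rewrite (lin_sum (la n)) big1 // => i _; rewrite linZ // aw ?scaler0.
have gnz : g != 0.
  apply/eqP => g0.
  have := annihilator_eigen mu n lf fv; rewrite {1}vE g0 add0r ap => /esym/eqP.
  rewrite scaler_eq0 (negbTE vnz) orbF => /prodf_eq0[i _].
  rewrite subr_eq0 => /eqP h; have := ltn_ord i.
  by rewrite -(inj n i) ?ltnn // ltnW // ltnS.
have og i : (i < n)%N -> ip g (w i) = 0 by exact: ip_sub_proj.
set c := ((hn g)^-1)%:C%C.
exists (fun i => if i == n then c *: g else w i).
have on := orthonormal_extend ow og gnz.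
have fg h : (forall i, (i < n)%N -> ip (w i) h = 0) ->
    ip (f g) h = mu n * ip g h.
  move=> hh; rewrite linB // fv ipBl ipZl vE ipDl.
  rewrite (lin_sum lf) ip_suml big1 ?subr0.
    congr (_ * _); rewrite ip_suml big1 ?addr0 // => i _.
    by rewrite ipZl hh // mulr0.
  by move=> i _; rewrite linZ // ipZl tw // mulr0.
have ogn i : (i < n)%N -> ip (w i) (c *: g) = 0.
  by move=> ni; rewrite ipZr (ip_eq0C (og _ ni)) mulr0.
split; first exact: on.
split; [|split].
- move=> i; rewrite ltnS leq_eqVlt; case: eqVneq => [-> _|_ /=]; last exact: dw.
  rewrite linZ // ipZl fg // mulrCA -ipZl.
  by have := on n n (leqnn _) (leqnn _); rewrite eqxx => ->; rewrite mulr1.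
- move=> h hh; have hw i : (i < n)%N -> ip (w i) h = 0.
    by move=> ni; have := hh i (ltnW ni); rewrite ltn_eqF.
  move=> i; rewrite ltnS leq_eqVlt; case: eqVneq => [-> _|_ /=]; last exact: tw.
  rewrite linZ // ipZl fg // mulrCA -ipZl.
  by have := hh n (leqnn _); rewrite eqxx => ->; rewrite mulr0.
- move=> i; rewrite ltnS leq_eqVlt; case: eqVneq => [-> _|_ /=] /=; last first.
    by move=> ni; rewrite aw // lin0 // scaler0 subr0.
  rewrite linZ // /g linB // ap subr0 (annihilator_eigen _ _ lf fv).
  rewrite !(linZ lf) fv !scalerA -scalerBl.
  by rewrite [X in X *: _](_ : _ = 0) ?scale0r //; ring.
Qed.

(** On the orthonormal vectors of [triangularize] the form takes the eigenvalues as values, each at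
    least [eps] below the bound [- (2 * eps)]; so each vector needs [eps] of the correction term.
    Exchanging the sums, Bessel for each [e i] limits the total correction to [K * d]. *)
Lemma count_eigenvalues f mu v n d e (eps K : R) : bop f -> orthofamily d e ->
  0 <= K ->
  (forall x, - (2 * eps) * nsq x <=
     Re (ip (f x) x) + K * \sum_(i < d) normc (ip x (e i)) ^+ 2) ->
  (forall i j, (i < n)%N -> (j < n)%N -> mu i = mu j -> i = j) ->
  (forall i, (i < n)%N ->
     [/\ v i != 0, f (v i) = mu i *: v i & Re (mu i) <= - (3 * eps)]) ->
  n%:R * eps <= K * d%:R.
Proof.
move=> [lf _] oe K0 hf inj eig.
have [|w [ow dw]] := triangularize (v := v) lf inj.
  by move=> i /eig[].
have n1 i : (i < n)%N -> nsq (w i) = 1 by move=> ni; rewrite /nsq ow // eqxx.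
have h : n%:R * eps <= \sum_(j < n) K * \sum_(i < d) normc (ip (w j) (e i)) ^+ 2.
  rewrite -[n in n%:R]card_ord -sum1_card natr_sum mulr_suml; apply: ler_sum => i _.
  have := hf (w i); rewrite n1 // dw //; have [_ _] := eig i (ltn_ord i).
  by move: (Re _) (K * _) => A B; lra.
apply: le_trans h _; rewrite -mulr_sumr ler_wpM2l // exchange_big /=.
rewrite -[d in d%:R]card_ord -sum1_card natr_sum; apply: ler_sum => i _.
have -> : 1%:R = nsq (e i) by rewrite /nsq oe // eqxx.
apply: le_trans (bessel (e i) ow); apply: ler_sum => j _.
by rewrite (ipC (e i)) normc_conjc.
Qed.

End FiniteRank.

(** * Averaging a polynomial over a circle *)

Section CircleAverage.
Variable R : realType.
Implicit Types (z w : R[i]).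

(** With a power of two the order is forced: for a [2 ^ m]-th root of -1 it divides [2 ^ m.+1] but
    not [2 ^ m]. *)
Lemma prim_root_pow2 m : exists w : R[i], (2 ^ m.+1)%N.-primitive_root w.
Proof.
pose w : R[i] := (2 ^ m)%N.-root (-1).
have wm : w ^+ (2 ^ m) = -1 by rewrite rootCK // expn_gt0.
have wN : w ^+ (2 ^ m.+1) = 1 by rewrite expnSr exprM wm sqrrN expr1n.
have [|n pn] := prim_order_exists _ wN; first by rewrite expn_gt0.
move=> dn; exists w; suff <- : n = (2 ^ m.+1)%N by [].
have /(dvdn_pfactor _ _ (isT : prime 2)) [a am na] := dn; rewrite na.
congr (_ ^ _)%N; apply/eqP; rewrite eqn_leq am leqNgt; apply/negP => lt.
have : (n %| 2 ^ m)%N by rewrite na dvdn_exp2l.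
rewrite (prim_order_dvd pn) wm => /eqP h.
have : (2 : R[i]) == 0 by rewrite -[2]/(1 + 1) -{1}h addNr.
by rewrite pnatr_eq0.
Qed.

Lemma prim_root_sum N (w : R[i]) a : N.-primitive_root w ->
  \sum_(i < N) w ^+ (a * i) = if (N %| a)%N then N%:R else 0.
Proof.
move=> pw; rewrite (prim_order_dvd pw); case: eqP => [wa|/eqP wa].
  rewrite -[N in N%:R]card_ord -sum1_card natr_sum; apply: eq_bigr => i _.
  by rewrite exprM wa expr1n.
have h := subrX1 (w ^+ a) N.
have : (w ^+ a) ^+ N - 1 = 0 by rewrite exprAC (prim_expr_order pw) expr1n subrr.
rewrite h => /eqP; rewrite mulf_eq0 subr_eq0 (negbTE wa) /= => h0.
by rewrite -[RHS](eqP h0); apply: eq_bigr => i _; rewrite exprM.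
Qed.

Lemma normc_prim_root N w : N.-primitive_root w -> normc w = 1.
Proof.
move=> pw; have N0 := prim_order_gt0 pw.
apply/eqP; rewrite -(@eqrXn2 _ N) ?normc_ge0 // -normcX (prim_expr_order pw).
by rewrite Normc.normc1 expr1n.
Qed.

(* The average of [p] over a circle against the positive weight
   [2 + 2 Re (zeta w ^- l)] isolates the coefficient of degree [l]. *)
Lemma circle_min (c : nat -> R[i]) k l0 (rho : R) :
  (l0 < k)%N -> c l0 != 0 -> 0 < rho ->
  exists2 z, normc z = rho &
    Re (\sum_(l < k) c l * z ^+ l.+1) <= - (normc (c l0) * rho ^+ l0.+1 / 4).
Proof.
move=> lk cnz rho0.
have s0 : 0 < normc (c l0) by rewrite lt_def normc_ge0 normc_eq0 cnz.
(* Since [N > 2k], the exponents [l.+1] and [l.+1 + l0.+1] are never multiples of [N], and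
   [l.+1 + (N - l0.+1)] is one only for [l = l0]. *)
pose N := (2 ^ (2 * k).+1)%N; have [w pw] := prim_root_pow2 (2 * k).
have kN : (2 * k < N)%N.
  by apply: (leq_trans (ltn_expl (2 * k) (isT : 1 < 2)%N)); rewrite leq_exp2l.
have nw := normc_prim_root pw.
(* The unit number with [zeta * c l0 = - normc (c l0)], so that the surviving coefficient is real
   and negative. *)
have [zeta zetaE] : exists zeta, zeta = - ((c l0)^*)%C / (normc (c l0))%:C%C.
  by eexists.
have nzeta : normc zeta = 1.
  by rewrite zetaE Normc.normcM (normcN (_^*)%C) normc_conjc Normc.normcV normcR
     ger0_norm ?normc_ge0 // mulfV // gt_eqF.
pose t := normc (c l0) * rho ^+ l0.+1.
have t0 : 0 < t by rewrite mulr_gt0 // exprn_gt0.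
apply: contrapT => /forall2NP noz.
pose z i := rho%:C%C * w ^+ i.
have nz i : normc (z i) = rho.
  by rewrite /z Normc.normcM normcX nw expr1n mulr1 normcR ger0_norm // ltW.
pose p i := \sum_(l < k) c l * (z i) ^+ l.+1.
have rp i : - (t / 4) <= Re (p i).
  have [h|/negP] := noz (z i); first by case: h.
  by rewrite -ltNge => /ltW.
pose W i := 2 + 2 * Re (zeta * w ^+ ((N - l0.+1) * i)).
have W0 i : 0 <= W i.
  have := Re_ge_normc (zeta * w ^+ ((N - l0.+1) * i)).
  by rewrite Normc.normcM nzeta normcX nw expr1n mulr1 /W; lra.
have lN : (l0.+1 <= N)%N by lia.
have WE i : (W i)%:C%C = 2 + zeta * w ^+ ((N - l0.+1) * i)
    + ((zeta)^*)%C * w ^+ (l0.+1 * i).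
  have -> : ((zeta)^*)%C * w ^+ (l0.+1 * i) = ((zeta * w ^+ ((N - l0.+1) * i))^*)%C.
    rewrite conjcM; set u := w ^+ ((N - l0.+1) * i).
    suff -> : w ^+ (l0.+1 * i) = (u^*)%C by [].
    have uv : w ^+ (l0.+1 * i) * u = 1.
      by rewrite -exprD -mulnDl subnKC // exprM (prim_expr_order pw) expr1n.
    have uu : u * (u^*)%C = 1 by rewrite mulcJ normcX nw !expr1n.
    by rewrite -[LHS]mulr1 -uu mulrA uv mul1r.
  rewrite -addrA /W; set u := zeta * _.
  by case: u => x y; apply/complexP => /=; ring.
have sumW : \sum_(i < N) W i = 2 * N%:R.
  apply: (@complexI R); rewrite rmorph_sum /=.
  under eq_bigr => i _ do rewrite WE.
  rewrite !big_split /= -!mulr_sumr !(prim_root_sum _ pw).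
  rewrite !gtnNdvd ?subn_gt0 ?ltn_subrL //; try lia.
  rewrite !mulr0 !addr0 sumr_const card_ord rmorphM !rmorph_nat.
  by rewrite mulr2n mulrDl mul1r.
have sumpW : \sum_(i < N) p i * (W i)%:C%C = - (N%:R * t)%:C%C.
  pose q l := c l * rho%:C%C ^+ l.+1.
  have -> : \sum_(i < N) p i * (W i)%:C%C = \sum_(i < N) \sum_(l < k)
     (q l * (2 * w ^+ (l.+1 * i) + zeta * w ^+ ((l.+1 + (N - l0.+1)) * i)
        + (zeta^*)%C * w ^+ ((l.+1 + l0.+1) * i))).
    apply: eq_bigr => i _; rewrite mulr_suml; apply: eq_bigr => l _.
    rewrite WE /z exprMn -exprM /q [(i * _)%N]mulnC !mulnDl !exprD; ring.
  rewrite exchange_big /= (bigD1 (Ordinal lk)) //= [X in _ + X]big1 ?addr0.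
    rewrite -mulr_sumr !big_split /= -!mulr_sumr !(prim_root_sum _ pw).
    rewrite subnKC // dvdnn !gtnNdvd //; try lia.
    rewrite !mulr0 addr0 add0r /q zetaE -fmorphV.
    have -> : c l0 * rho%:C%C ^+ l0.+1 * (- ((c l0)^*)%C * ((normc (c l0))^-1)%:C%C * N%:R)
      = - ((c l0 * ((c l0)^*)%C) * rho%:C%C ^+ l0.+1 * ((normc (c l0))^-1)%:C%C * N%:R) by ring.
    rewrite mulcJ -rmorphXn /= -(rmorph_nat (real_complex R)) -!rmorphM -!rmorphN /=.
    by congr (- _)%:C%C; rewrite /t; field; rewrite gt_eqF.
  move=> l; rewrite -val_eqE /= => ll.
  rewrite -mulr_sumr !big_split /= -!mulr_sumr !(prim_root_sum _ pw).
  have lk' := ltn_ord l.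
  have -> : (N %| l.+1)%N = false by rewrite gtnNdvd //; lia.
  have -> : (N %| l.+1 + l0.+1)%N = false by rewrite gtnNdvd //; lia.
  have [lt|le] := ltnP l l0.
    by rewrite gtnNdvd ?mulr0 ?addr0 ?mulr0 //; lia.
  have -> : (l.+1 + (N - l0.+1) = N + (l - l0))%N by lia.
  by rewrite dvdn_addr // gtnNdvd ?mulr0 ?addr0 ?mulr0 //; lia.
(* The weights sum to [2 * N], so a lower bound [- (t / 4)] on the real parts gives at least
   [- (N * t / 2)], above the true value [- (N * t)]. *)
have : - (N%:R * t) >= \sum_(i < N) W i * - (t / 4).
  have /(congr1 (@complex.Re R)) := sumpW; rewrite Re_sum /= => <-.
  by apply: ler_sum => i _; rewrite [p _ * _]mulrC ReZ ler_wpM2l.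
rewrite -mulr_suml sumW.
have : 0 < N%:R :> R by rewrite ltr0n; lia.
by move=> N0; have := mulr_gt0 N0 t0; move: (N%:R) => M; lra.
Qed.

End CircleAverage.

(** * Directions of the joint numerical range *)

Lemma finite_of_bounded_uniq (X : eqType) (P : X -> Prop) n :
  (forall s : seq X, uniq s -> (forall x, x \in s -> P x) -> (size s <= n)%N) ->
  exists s : seq X, (forall x, x \in s -> P x) /\ forall x, P x -> x \in s.
Proof.
elim: n P => [|n IH] P h.
  exists [::]; split=> // x Px.
  suff: (size [:: x] <= 0)%N by [].
  by apply: h => // y; rewrite inE => /eqP ->.
have [[x Px]|noP] := pselect (exists x, P x); last first.
  by exists [::]; split=> // x Px; case: noP; exists x.
have [s us hs|s [sP Ps]] := IH (fun y => P y /\ y != x).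
  rewrite -ltnS; apply: (h (x :: s)); last first.
    by move=> y; rewrite inE => /orP[/eqP -> //|/hs[]].
  by rewrite /= us andbT; apply/negP => /hs[_]; rewrite eqxx.
exists (x :: s); split=> y; rewrite inE.
  by move=> /orP[/eqP -> //|/sP[]].
by case: eqVneq => //= yx Py; exact: Ps.
Qed.

Lemma exp_unbounded (R : realType) (a b D : R) : 0 < a -> a < b -> 0 < D ->
  exists n : nat, D * a ^+ n < b ^+ n.
Proof.
move=> a0 ab D0; pose h := b / a - 1.
have h0 : 0 < h by rewrite subr_gt0 ltr_pdivlMr // mul1r.
have bern n : 1 + n%:R * h <= (b / a) ^+ n.
  elim: n => [|n IH]; first by rewrite mul0r addr0.
  have -> : b / a = 1 + h by rewrite /h; lra.
  move: IH; have -> : b / a = 1 + h by rewrite /h; lra.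
  rewrite exprS => IH; have hn0 : 0 <= n%:R :> R by [].
  have : (1 + h) * (1 + n%:R * h) <= (1 + h) * (1 + h) ^+ n.
    by rewrite ler_wpM2l //; lra.
  apply: le_trans; rewrite -natr1; have := mulr_ge0 hn0 (mulr_ge0 (ltW h0) (ltW h0)).
  by move: (n%:R) => N; nra.
exists (Num.truncn (D / h)).+1; set n := _.+1.
have : D / h < n%:R by exact: truncnS_gt.
rewrite ltr_pdivrMr // => Dn.
have := bern n; rewrite expr_div_n ler_pdivlMr ?exprn_gt0 //.
apply: lt_le_trans; rewrite ltr_pM2r ?exprn_gt0 //; lra.
Qed.

Section SpectralNumericalRange.
Variables (R : realType) (H : hilbert R).
Implicit Types (x y z : H) (F : seq H).

Lemma binv_factor (B D g : H -> H) : bop D -> bop g ->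
  (forall x, B x = D (g x)) -> (forall x, B x = g (D x)) -> binv B -> binv D.
Proof.
move=> bD bg BDg BgD [S [bS BS SB]]; exists (g \o S).
have DgS y : D (g (S y)) = y by rewrite -BDg SB.
split=> [|x|y /=]; [exact: bop_comp| |exact: DgS].
rewrite /= -[LHS]BS -[RHS]BS; congr S.
by rewrite [LHS]BgD DgS -BgD.
Qed.

Lemma bop_sub_scale (f : H -> H) (a : R[i]) : bop f -> bop (fun x => f x - a *: x).
Proof.
move=> bf; rewrite (_ : (fun x => _) = fun x => f x + - a *: x).
  by apply: bopD => //; apply: bopZ; exact: bop_id.
by apply/funext => x; rewrite scaleNr.
Qed.

Definition opoly (T : H -> H) k (c : nat -> R[i]) x : H :=
  \sum_(l < k) c l *: iter l.+1 T x.

Definition cpoly k (c : nat -> R[i]) : {poly R[i]} :=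
  \sum_(l < k) c l *: 'X^(l.+1).

Lemma cpolyE k c (z : R[i]) : (cpoly k c).[z] = \sum_(l < k) c l * z ^+ l.+1.
Proof. by rewrite horner_sum; apply: eq_bigr => i _; rewrite !hornerE. Qed.

Variable T : H -> H.
Hypothesis bT : bop T.

Lemma bop_opoly k c : bop (opoly T k c).
Proof. by apply: bop_sum => i; apply: bopZ; exact: bop_iter. Qed.

Lemma iter_factor (z : R[i]) l : exists g, [/\ bop g,
  forall x, iter l T x - z ^+ l *: x = T (g x) - z *: g x &
  forall x, iter l T x - z ^+ l *: x = g (T x - z *: x)].
Proof.
have [lT _] := bT.
elim: l => [|l [g [bg h1 h2]]].
  exists (fun=> 0); split=> [|x|x]; first exact: bop0.
    by rewrite expr0 scale1r subrr (lin0 lT) scaler0 subr0.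
  by rewrite expr0 scale1r subrr.
have [lg _] := bg.
exists (fun x => T (g x) + z ^+ l *: x); split=> [|x|x].
- by apply: bopD; [exact: (bop_comp bT bg)|apply: bopZ; exact: bop_id].
- rewrite (linD lT) (linZ lT) scalerDr opprD addrACA scalerA -exprS.
  rewrite -(linZ lT) -(linB lT) -h1 (linB lT) (linZ lT) /=.
  by rewrite addrA subrK.
- rewrite -h2 (linB lT) (linZ lT) scalerBr scalerA -exprSr /=.
  by rewrite addrA subrK.
Qed.

(** The half of the spectral mapping theorem placing [p(w)] in the spectrum of [p(T)] for [w] in
    that of [T]: [p(T) - p(z)] factors through [T - z] on both sides. *)
Lemma opoly_spectrum k c (z : R[i]) :
  binv (fun x => opoly T k c x - (cpoly k c).[z] *: x) ->
  binv (fun x => T x - z *: x).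
Proof.
have [lT _] := bT.
have /choice[g hg] : forall l : nat, exists g, [/\ bop g,
  forall x, iter l T x - z ^+ l *: x = T (g x) - z *: g x &
  forall x, iter l T x - z ^+ l *: x = g (T x - z *: x)] by exact: iter_factor.
apply: (@binv_factor _ _ (fun x => \sum_(l < k) c l *: g l.+1 x)).
- exact: bop_sub_scale.
- by apply: bop_sum => l; apply: bopZ; have [] := hg l.+1.
- move=> x; rewrite (lin_sum lT) scaler_sumr -sumrB cpolyE scaler_suml -sumrB.
  apply: eq_bigr => l _; have [_ h _] := hg l.+1.
  by rewrite (linZ lT) scalerA [z * _]mulrC -!scalerA -!scalerBr h.
- move=> x; rewrite cpolyE scaler_suml -sumrB.
  apply: eq_bigr => l _; have [_ _ h] := hg l.+1.
  by rewrite -scalerA -scalerBr h.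
Qed.

(* [-2 eps] absorbs the cross terms between [F^\perp] and [span F]. *)
Lemma numerical_range_correction (A : H -> H) F (eps : R) : bop A -> 0 < eps ->
  (forall x, (forall y, y \in F -> ip x y = 0) -> - eps * nsq x <= Re (ip (A x) x)) ->
  exists (K : R) d e, [/\ 0 <= K, orthofamily d e &
    forall x, - (2 * eps) * nsq x <=
      Re (ip (A x) x) + K * \sum_(i < d) normc (ip x (e i)) ^+ 2].
Proof.
move=> [lA [L L0 hL]] eps0 hF.
have [d [e [oe he]]] := gram_schmidt F.
exists (L ^+ 2 / eps + L), d, e; split=> //.
  by rewrite addr_ge0 ?divr_ge0 ?sqr_ge0 // ltW.
move=> x; rewrite -(nsq_orthonormal_sum (fun i => ip x (e i)) oe) -/(proj d e x).
set q := proj d e x; have [m mE] : exists m, m = x - q by eexists.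
have om i : (i < d)%N -> ip m (e i) = 0 by rewrite mE; exact: ip_sub_proj.
have mq : ip m q = 0.
  rewrite /q /proj ip_sumr big1 // => i _.
  by rewrite ipZr om ?mulr0.
have -> : x = m + q by rewrite mE subrK.
have Fm := hF m (he m om).
rewrite (linD lA) ipDl !ipDr !ReD (nsq_pyth mq) -!hn2.
rewrite -hn2 in Fm.
have b u v : - (L * hn u * hn v) <= Re (ip (A u) v).
  apply: le_trans (Re_ge_normc _); rewrite lerN2.
  by apply: le_trans (cauchy_schwarz _ _) _; rewrite ler_wpM2r ?hn_ge0.
have b1 := b m q; have b2 := b q m; have b3 := b q q.
have am : 2 * L * hn m * hn q <= eps * hn m ^+ 2 + L ^+ 2 / eps * hn q ^+ 2.
  rewrite -subr_ge0.
  have -> : eps * hn m ^+ 2 + L ^+ 2 / eps * hn q ^+ 2 - 2 * L * hn m * hn q =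
     (eps * hn m - L * hn q) ^+ 2 / eps by field; rewrite gt_eqF.
  by rewrite divr_ge0 ?sqr_ge0 // ltW.
have q0 := mulr_ge0 (ltW eps0) (sqr_ge0 (hn q)).
move: b1 b2 b3 am Fm q0; move: (Re _) (Re _) (Re _) (Re _) => r1 r2 r3 r4.
move: (L ^+ 2 / eps) (hn m) (hn q) => Le u v.
lra.
Qed.

(** Adding the finite-rank correction to [A - mu] gives a form with real part at least
    [(3 - 2) * eps] times the squared norm, hence an invertible operator. By [fredholm], [A - mu]
    can then fail to be invertible only through its kernel. *)
Lemma eigenvector_of_singular (A : H -> H) (K : R) d (e : nat -> H) (eps : R) (mu : R[i]) :
  bop A -> 0 < eps ->
  (forall x, - (2 * eps) * nsq x <=
      Re (ip (A x) x) + K * \sum_(i < d) normc (ip x (e i)) ^+ 2) ->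
  Re mu <= - (3 * eps) -> ~ binv (fun x => A x - mu *: x) ->
  exists2 v, v != 0 & A v = mu *: v.
Proof.
move=> bA eps0 hA hmu nb; apply: contrapT => nov; apply: nb.
pose Q x := \sum_(i < d) ip x (e i) *: (K%:C%C *: e i).
have bQ : bop Q by apply: bop_sum => i; exact: bop_ip.
have QE x : Re (ip (Q x) x) = K * \sum_(i < d) normc (ip x (e i)) ^+ 2.
  rewrite ip_suml Re_sum mulr_sumr; apply: eq_bigr => i _.
  by rewrite !ipZl (ipC (e i)) mulrCA mulcJ -rmorphM.
have bC : bop (fun x => (A x - mu *: x) + Q x).
  by apply: bopD => //; exact: bop_sub_scale.
apply: (fredholm (n := d) (e := e) (v := fun i => K%:C%C *: e i) _ bC).
- apply: lax_milgram bC eps0 _ => x.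
  apply: le_trans (Re_le_normc _).
  rewrite ipDl ipBl ipZl ReD ReB QE ipxx [mu * _]mulrC ReZ.
  have := hA x; have := nsq_ge0 x; move: (Re (ip _ _)) (K * _) (nsq x) hmu => r s t.
  by move=> hmu t0 h; have := ler_wpM2l t0 hmu; lra.
- by move=> x; rewrite /= -/(Q x) addrK.
- move=> x /eqP; rewrite subr_eq0 => /eqP Ax; apply/eqP/negPn/negP => xnz.
  by apply: nov; exists x.
Qed.

Lemma normc_singular (A : H -> H) (L : R) (mu : R[i]) :
  bop A -> (forall x, hn (A x) <= L * hn x) ->
  ~ binv (fun x => A x - mu *: x) -> normc mu <= L.
Proof.
move=> bA hL nb; rewrite leNgt; apply/negP => lt; apply: nb.
apply: (@lax_milgram _ _ _ (normc mu - L)); rewrite ?subr_gt0 //.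
  exact: bop_sub_scale.
move=> x; rewrite ipBl ipZl ipxx.
have h1 : normc (ip (A x) x) <= L * nsq x.
  apply: le_trans (cauchy_schwarz _ _) _.
  by rewrite -hn2 expr2 mulrA ler_wpM2r ?hn_ge0.
have h2 : normc mu * nsq x = normc (mu * (nsq x)%:C%C).
  by rewrite Normc.normcM normcR ger0_norm ?nsq_ge0.
have h3 : normc (mu * (nsq x)%:C%C) <=
    normc (ip (A x) x - mu * (nsq x)%:C%C) + normc (ip (A x) x).
  set u := mu * _; set v := ip _ _; have {1}-> : u = - (v - u) + v by rewrite opprB subrK.
  by apply: le_trans (normcD _ _) _; rewrite (normcN (v - u)).
rewrite mulrBl h2; lra.
Qed.

(* [r0] is the radius of a disc contained in the polynomial hull of the
   spectrum of [T]. *)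
Variable r0 : R.
Hypothesis r0_gt0 : 0 < r0.
Hypothesis hullT : forall (z : R[i]), normc z < r0 -> forall (q : {poly R[i]}) (b : R),
  (forall w, ~ binv (fun x => T x - w *: x) -> normc q.[w] <= b) -> normc q.[z] <= b.

(** The 16 is 4 from [circle_min] times 4 from the value [-4 eps] wanted at the separated point;
    [r ^+ k] bounds every [rho ^+ l0.+1] from below, for radii [rho >= r] with [r <= 1]. *)
Lemma numerical_range_direction k F (c : nat -> R[i]) l0 (r : R) :
  0 < r -> r <= 1 -> 2 * r <= r0 ->
  (l0 < k)%N -> c l0 != 0 ->
  exists x, [/\ nsq x = 1, forall y, y \in F -> ip x y = 0 &
    Re (ip (opoly T k c x) x) <= - (r ^+ k / 16 * normc (c l0))].
Proof.
move=> rgt0 r1 rr0 lk cnz.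
pose A := opoly T k c; have bA : bop A by exact: bop_opoly.
pose p := cpoly k c.
have s0 : 0 < normc (c l0) by rewrite lt_def normc_ge0 normc_eq0 cnz.
pose eps := r ^+ k / 16 * normc (c l0).
have eps0 : 0 < eps by rewrite mulr_gt0 // divr_gt0 // exprn_gt0.
apply: contrapT => nox.
have hF x : (forall y, y \in F -> ip x y = 0) -> - eps * nsq x <= Re (ip (A x) x).
  move=> Fx; have [->|xnz] := eqVneq x 0.
    by rewrite nsq0 mulr0 ip0r.
  rewrite leNgt; apply/negP => lt; apply: nox.
  have hx : 0 < hn x by rewrite lt_def hn_ge0 hn_eq0 xnz.
  exists (((hn x)^-1)%:C%C *: x); split.
  - rewrite nsqZ normcR ger0_norm ?invr_ge0 ?hn_ge0 // exprVn hn2 mulVf //.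
    by rewrite gt_eqF // nsq_gt0.
  - by move=> y /Fx; rewrite ipZl => ->; rewrite mulr0.
  - have [lA _] := bA; rewrite -/A (linZ lA) ipZl ipZr conjc_real !ReZ.
    rewrite -/eps mulrA -expr2 exprVn hn2 mulrC ler_pdivrMr ?nsq_gt0 //.
    exact: ltW.
have [K [d [e [K0 oe hA]]]] := numerical_range_correction bA eps0 hF.
pose P mu := Re mu <= - (3 * eps) /\ ~ binv (fun x => A x - mu *: x).
have [s [sP Ps]] : exists s : seq R[i], (forall w, w \in s -> P w) /\ forall w, P w -> w \in s.
  apply: (@finite_of_bounded_uniq _ P (Num.truncn (K * d%:R / eps))) => s us hs.
  have /choice[v hv] : forall mu, exists v, mu \in s -> v != 0 /\ A v = mu *: v.
    move=> mu; have [ms|ms] := boolP (mu \in s); last by exists 0.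
    have [h1 h2] := hs mu ms.
    by have [v v0 Av] := eigenvector_of_singular bA eps0 hA h1 h2; exists v.
  have : (size s)%:R * eps <= K * d%:R.
    apply: (@count_eigenvalues _ _ A (nth 0 s) (fun i => v (nth 0 s i)) _ _ _ _ _ bA oe K0 hA).
      by move=> i j hi hj /eqP; rewrite nth_uniq // => /eqP.
    move=> i hi; have ms := mem_nth 0 hi; have [v1 v2] := hv _ ms.
    by split=> //; have [] := hs _ ms.
  have h0 : 0 <= K * d%:R / eps by apply: divr_ge0; [exact: mulr_ge0|exact: ltW].
  by rewrite (truncn_ge_nat _ h0) ler_pdivlMr.
pose Q := \prod_(mu <- s) (p - mu%:P).
have Qroot (z : R[i]) : root Q z = (p.[z] \in s).
  rewrite /root horner_prod prodf_seq_eq0; apply/hasP/idP => [[mu ms]|ps].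
    by rewrite /= !hornerE subr_eq0 => /eqP ->.
  by exists p.[z] => //=; rewrite !hornerE subrr.
have pc : p`_l0.+1 = c l0.
  rewrite coef_sum (bigD1 (Ordinal lk)) //= coefZ coefXn eqxx mulr1.
  rewrite big1 ?addr0 // => i; rewrite -val_eqE /= => il.
  by rewrite coefZ coefXn eqSS eq_sym (negbTE il) mulr0.
have Q0 : Q != 0.
  rewrite prodf_seq_neq0; apply/allP => mu _ /=; apply/eqP => h.
  have := congr1 (fun q : {poly R[i]} => q`_l0.+1) h.
  by rewrite coefB coefC /= subr0 pc coef0 => /eqP; exact/negP.
(* [size Q] distinct radii in [[r, 2 r)] give that many distinct points, more than [Q] has roots, so
   one of them avoids the roots. *)
have [z0 [nz0 pz0 Qz0]] : exists z : R[i],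
    [/\ normc z < r0, Re p.[z] <= - (4 * eps) & Q.[z] != 0].
  pose n := size Q; pose rho i := r * (1 + i%:R / n.+1%:R) : R.
  have n0 : 0 < n.+1%:R :> R by [].
  have /choice[z hz] : forall i : nat, exists z : R[i], normc z = rho i /\
      Re p.[z] <= - (normc (c l0) * rho i ^+ l0.+1 / 4).
    move=> i; have [|z z1 z2] := @circle_min R c k l0 (rho i) lk cnz.
      by rewrite mulr_gt0 // ltr_pwDl // divr_ge0.
    by exists z; rewrite cpolyE.
  have [i [hi Qi]] : exists i, (i < n)%N /\ Q.[z i] != 0.
    apply: contrapT => noi.
    have := @max_poly_roots _ Q [seq z i | i <- iota 0 n] Q0.
    rewrite size_map size_iota ltnn => h; suff: false by []; apply: h.
      rewrite all_map; apply/allP => i; rewrite mem_iota add0n => /andP[_ hi] /=.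
      by apply/negPn/negP => h; apply: noi; exists i.
    rewrite map_inj_in_uniq ?iota_uniq // => i j _ _ zij.
    have [zi _] := hz i; have [zj _] := hz j.
    have : rho i = rho j by rewrite -zi -zj zij.
    rewrite /rho => /(mulfI (lt0r_neq0 rgt0)) /addrI.
    have nn : n.+1%:R^-1 != 0 :> R by rewrite invr_eq0 pnatr_eq0.
    by move=> /(mulIf nn) /eqP; rewrite eqr_nat => /eqP.
  have [zi pzi] := hz i.
  have fr0 : 0 <= i%:R / n.+1%:R :> R by rewrite divr_ge0.
  have fr1 : i%:R / n.+1%:R < 1 :> R by rewrite ltr_pdivrMr // mul1r ltr_nat ltnS ltnW.
  exists (z i); split=> //.
    rewrite zi; apply: lt_le_trans rr0; rewrite /rho mulrC ltr_pM2r //.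
    by move: (_ / _) fr1 => t t1; lra.
  apply: le_trans pzi _; rewrite lerN2 /eps.
  have h1 : r ^+ k <= rho i ^+ l0.+1.
    apply: (@le_trans _ _ (r ^+ l0.+1)).
      by apply: ler_wiXn2l => //; exact: ltW.
    rewrite lerXn2r ?nnegrE ?mulr_ge0 ?addr_ge0 // ?(ltW rgt0) //.
    by rewrite /rho ler_peMr ?(ltW rgt0) // lerDl.
  have := ler_wpM2l (ltW s0) h1; lra.
have [lA [L L0 hL]] := bA.
have spec w : ~ binv (fun x => T x - w *: x) ->
    normc p.[w] <= L /\ (Q.[w] = 0 \/ - (3 * eps) < Re p.[w]).
  move=> nb; have nA : ~ binv (fun x => A x - p.[w] *: x).
    by move=> /opoly_spectrum.
  split; first exact: normc_singular nA.
  have [pw|pw] := leP (Re p.[w]) (- (3 * eps)); last by right.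
  by left; apply/eqP; rewrite -/(root Q w) Qroot; apply: Ps.
pose D := \prod_(mu <- s) (L + normc mu + 1).
have D0 : 0 < D.
  by rewrite /D big_seq prodr_gt0 // => mu _; have := normc_ge0 mu; lra.
have QD w : normc p.[w] <= L -> normc Q.[w] <= D.
  move=> pw; rewrite horner_prod /D.
  elim: s {Ps sP Qroot Q Q0 Qz0 spec D D0} => [|mu s IH]; first by rewrite !big_nil Normc.normc1.
  rewrite !big_cons Normc.normcM ler_pM ?normc_ge0 // !hornerE.
  by apply: le_trans (normcB _ _) _; lra.
(* This balances the quadratic term: [rho ^+ 2 * normc p.[w] ^+ 2 <= rho * eps] where [normc p.[w]
   <= L]. Thus [normc h.[w] ^+ 2] is at most [1 + (6 + 1) rho eps] at spectral points outside the
   roots of [Q], but at least [1 + 8 rho eps] at [z0]; a high power of [h] then outweighs [D]. *)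
pose rho := eps / L ^+ 2.
have L20 : 0 < L ^+ 2 by exact: exprn_gt0.
have rho0 : 0 < rho by exact: divr_gt0.
have rhoL : rho * L ^+ 2 = eps by rewrite /rho divfK // gt_eqF.
pose h : {poly R[i]} := 1 - rho%:C%C *: p.
have hE w : normc h.[w] ^+ 2 = 1 - 2 * rho * Re p.[w] + rho ^+ 2 * normc p.[w] ^+ 2.
  have -> : h.[w] = 1 - rho%:C%C * p.[w] by rewrite /h !hornerE.
  rewrite !sqr_normc_Re_Im; case: (p.[w]) => a b; move: (rho) => t /=; ring.
pose al := 1 + 7 * rho * eps; pose be := 1 + 8 * rho * eps.
have re0 := mulr_gt0 rho0 eps0.
have Qz : 0 < normc Q.[z0] by rewrite lt_def normc_ge0 normc_eq0 Qz0.
have [N hN] := @exp_unbounded R al be (D ^+ 2 / normc Q.[z0] ^+ 2)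
  (ltac:(by rewrite /al; lra)) (ltac:(by rewrite /al /be; lra))
  (ltac:(by rewrite divr_gt0 ?exprn_gt0)).
have al0 : 0 <= al by rewrite /al; lra.
suff : normc (Q * h ^+ N).[z0] <= D * Num.sqrt al ^+ N.
  rewrite hornerM horner_exp Normc.normcM normcX leNgt => /negP; apply.
  rewrite -(@ltr_pXn2r _ 2) ?nnegrE ?mulr_ge0 ?exprn_ge0 ?normc_ge0 ?sqrtr_ge0 ?(ltW D0) //.
  rewrite !exprMn ![_ ^+ N ^+ 2]exprAC sqr_sqrtr //.
  rewrite [ltRHS]mulrC -ltr_pdivrMr ?exprn_gt0 // mulrAC.
  apply: (lt_le_trans hN).
  rewrite lerXn2r ?nnegrE ?sqr_ge0 //; first by rewrite /be; lra.
  rewrite hE /be.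
  have := ler_wpM2l (ltW rho0) pz0; have := mulr_ge0 (sqr_ge0 rho) (sqr_ge0 (normc p.[z0])).
  lra.
apply: hullT nz0 _ _ _ => w nb.
rewrite hornerM horner_exp Normc.normcM normcX.
have [pw []] := spec w nb.
  move=> ->; rewrite Normc.normc0 mul0r.
  by rewrite mulr_ge0 ?exprn_ge0 ?sqrtr_ge0 ?(ltW D0).
move=> Rw; apply: ler_pM; rewrite ?normc_ge0 ?exprn_ge0 ?normc_ge0 ?QD //.
rewrite lerXn2r ?nnegrE ?normc_ge0 ?sqrtr_ge0 //.
rewrite -(@ler_pXn2r _ 2) ?nnegrE ?normc_ge0 ?sqrtr_ge0 // sqr_sqrtr // hE.
have h1 : rho ^+ 2 * normc p.[w] ^+ 2 <= rho * eps.
  rewrite -rhoL mulrA -expr2 ler_wpM2l ?sqr_ge0 //.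
  by rewrite lerXn2r ?nnegrE ?normc_ge0 // ltW.
have h2 := ler_wpM2l (ltW rho0) (ltW Rw).
by rewrite /al; lra.
Qed.

End SpectralNumericalRange.

(** * Vectors with a prescribed compression *)

Lemma dependent_choice_seq (X : Type) (P : seq X -> X -> Prop) :
  (forall s, exists x, P s x) -> exists u : nat -> X, forall n, P (mkseq u n) (u n).
Proof.
move=> /choice[g hg].
pose L := fix L n := if n is m.+1 then rcons (L m) (g (L m)) else [::].
pose u n := g (L n).
have LE n : mkseq u n = L n by elim: n => // n IH; rewrite mkseqS IH.
by exists u => n; rewrite LE; exact: hg.
Qed.

Lemma geometric_small (R : realType) (q e : R) : 0 < q < 1 -> 0 < e ->
  exists N : nat, forall n : nat, (N <= n)%N -> q ^+ n <= e.
Proof.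
move=> /andP[q0 q1] e0.
have [N hN] := @exp_unbounded R q 1 e^-1 q0 q1 (ltac:(by rewrite invr_gt0)).
exists N => n Nn; move: hN; rewrite expr1n mulrC ltr_pdivrMr // mul1r => hN.
apply: le_trans (ltW hN).
by rewrite ler_wiXn2l // ltW.
Qed.

(** The case [l = 0] makes this include plain orthogonality. Asking both orders makes the relation
    symmetric and makes the forms of [T^l] additive on sums of mutually related vectors. *)
Definition tort (R : realType) (H : hilbert R) (T : H -> H) k (x y : H) : Prop :=
  forall l, (l <= k)%N -> ip (iter l T x) y = 0 /\ ip (iter l T y) x = 0.

Section PrescribedCompression.
Variables (R : realType) (H : hilbert R) (T : H -> H) (k : nat).
Hypothesis bT : bop T.
Hypothesis k_gt0 : (0 < k)%N.
Implicit Types (x y z : H) (E F : seq H) (w : nat -> R[i]).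

Let lin_iter l : linear (iter l T). Proof. by have [] := bop_iter l bT. Qed.

Lemma tortC x y : tort T k x y -> tort T k y x.
Proof. by move=> h l /h[]. Qed.

Lemma tort0 x : tort T k x 0.
Proof. by move=> l _; rewrite (lin0 (lin_iter l)) ip0l ip0r. Qed.

Lemma tortD x y z : tort T k x y -> tort T k x z -> tort T k x (y + z).
Proof.
move=> hy hz l lk; have [y1 y2] := hy l lk; have [z1 z2] := hz l lk.
by rewrite (linD (lin_iter l)) ipDr ipDl y1 y2 z1 z2 addr0.
Qed.

Lemma tortZ a x y : tort T k x y -> tort T k x (a *: y).
Proof.
move=> hy l lk; have [y1 y2] := hy l lk.
by rewrite (linZ (lin_iter l)) ipZr ipZl y1 y2 !mulr0.
Qed.

Lemma tort_sum (I : Type) (r : seq I) (P : pred I) (G : I -> H) x :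
  (forall i, P i -> tort T k x (G i)) -> tort T k x (\sum_(i <- r | P i) G i).
Proof.
move=> h; elim/big_rec: _ => [|i y Pi hy]; first exact: tort0.
by apply: tortD => //; exact: h.
Qed.

Lemma tort_tends (u : nat -> H) x y :
  tends u x -> (forall n, tort T k (u n) y) -> tort T k x y.
Proof.
move=> ux uy l lk; split.
  apply: (ip_lim0 (tends_bop (bop_iter l bT) ux)) => n.
  by have [] := uy n l lk.
apply: ip_eq0C; apply: (ip_lim0 ux) => n; apply: ip_eq0C.
by have [] := uy n l lk.
Qed.

Lemma ip_tort_sum l n (x : nat -> H) (a b : nat -> R[i]) : (l <= k)%N ->
  (forall i j, (i < n)%N -> (j < n)%N -> i != j -> tort T k (x i) (x j)) ->
  ip (iter l T (\sum_(i < n) a i *: x i)) (\sum_(i < n) b i *: x i) =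
  \sum_(i < n) a i * ((b i)^*)%C * ip (iter l T (x i)) (x i).
Proof.
move=> lk ox; rewrite (lin_sum (lin_iter l)) ip_suml; apply: eq_bigr => i _.
rewrite ip_sumr (bigD1 i) //= big1 ?addr0 => [|j ji].
  by rewrite (linZ (lin_iter l)) ipZl ipZr mulrA.
rewrite (linZ (lin_iter l)) ipZl ipZr.
have [] := ox i j (ltn_ord i) (ltn_ord j) _ l lk; first by rewrite eq_sym.
by move=> -> _; rewrite !mulr0.
Qed.

(* [T]-orthogonality to finitely many vectors is orthogonality to finitely many
   vectors, since the functionals [x |-> <T^l x, y>] are represented. *)
Lemma tort_as_orth E : exists F, forall x,
  (forall y, y \in F -> ip x y = 0) -> forall y, y \in E -> tort T k x y.
Proof.
have /choice[adj hadj] : forall p : nat * H, exists z, forall x,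
    ip (iter p.1 T x) p.2 = ip x z.
  by move=> p; apply: adjoint_exists; exact: bop_iter.
exists ([seq iter l T y | l <- iota 0 k.+1, y <- E] ++
        [seq adj (l, y) | l <- iota 0 k.+1, y <- E]) => x hx y yE l lk.
have lI : l \in iota 0 k.+1 by rewrite mem_iota.
split.
  rewrite (hadj (l, y)) hx // mem_cat; apply/orP; right.
  exact: (allpairs_f (fun l y => adj (l, y)) lI yE).
apply: ip_eq0C; rewrite hx // mem_cat; apply/orP; left.
exact: (allpairs_f (fun l y => iter l T y) lI yE).
Qed.

(** * Greedy approximation of a prescribed compression *)

Section Greedy.
Variable eta : R.
Hypothesis eta_gt0 : 0 < eta.
Hypothesis direction : forall F w, exists x, [/\ nsq x = 1,
  forall y, y \in F -> ip x y = 0 &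
  forall l, (l < k)%N -> Re (ip (opoly T k w x) x) <= - (eta * normc (w l))].

Let V x l := ip (iter l.+1 T x) x.

(** One greedy step. With mass [m] left and residual at most [kap * m], a piece of mass [th * m]
    whose values correlate with the residual brings the residual below [kap] times the new remaining
    mass, so the step can be repeated forever. *)
Lemma greedy_constants : exists kap th : R, [/\ 0 < kap, 0 < th < 1 &
  forall E w m, 0 < m -> \sum_(l < k) normc (w l) ^+ 2 <= (kap * m) ^+ 2 ->
  exists d, [/\ forall y, y \in E -> tort T k d y, nsq d = th * m &
    \sum_(l < k) normc (w l - V d l) ^+ 2 <= (kap * (m * (1 - th))) ^+ 2]].
Proof.
have [L [L1 hL]] : exists L : R, 1 <= L /\ forall x, nsq x = 1 ->
    \sum_(l < k) normc (V x l) ^+ 2 <= L ^+ 2.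
  have /choice[K hK] : forall l : nat, exists K : R, forall x, hn (iter l.+1 T x) <= K * hn x.
    by move=> l; have [_ [K _ hK]] := bop_iter l.+1 bT; exists K.
  exists (1 + \sum_(l < k) K l ^+ 2); split.
    by rewrite lerDl sumr_ge0 // => l _; rewrite sqr_ge0.
  move=> x x1; have hx : hn x = 1 by rewrite /hn x1 sqrtr1.
  have h : \sum_(l < k) normc (V x l) ^+ 2 <= \sum_(l < k) K l ^+ 2.
    apply: ler_sum => l _; have := cauchy_schwarz (iter l.+1 T x) x.
    have := hK l x; rewrite hx !mulr1 => h1 h2.
    have h3 := le_trans h2 h1.
    by rewrite lerXn2r ?nnegrE ?normc_ge0 //; apply: le_trans h3; exact: normc_ge0.
  have s0 : 0 <= \sum_(l < k) K l ^+ 2 by apply: sumr_ge0 => l _; rewrite sqr_ge0.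
  apply: le_trans h _; move: (\sum_(l < k) _) s0 => s s0; nra.
have k0 : 0 < k%:R :> R by rewrite ltr0n.
(* The factor [k] turns the bounds [eta * normc (w l) <= S] on single coordinates into
   [2 * kap * t <= S] for the Euclidean length [t]. *)
pose kap := Num.min 1 (eta / (2 * k%:R)).
have kap0 : 0 < kap by rewrite lt_min ltr01 divr_gt0 // mulr_gt0.
have kap1 : kap <= 1 by rewrite ge_min lexx.
have kapk : kap * (2 * k%:R) <= eta.
  by rewrite -ler_pdivlMr ?mulr_gt0 // ge_min lexx orbT.
have L0 : 0 < L by lra.
(* Makes the second-order error [(th * m) ^+ 2 * L ^+ 2] equal to [th * (kap * m) ^+ 2 / 2]. *)
pose th := kap ^+ 2 / (2 * L ^+ 2).
have thL : th * (2 * L ^+ 2) = kap ^+ 2.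
  by rewrite divfK // gt_eqF // mulr_gt0 // exprn_gt0.
have th0 : 0 < th by rewrite divr_gt0 ?mulr_gt0 ?exprn_gt0.
have LL : 1 <= L ^+ 2 by rewrite expr2; nra.
have kk : kap ^+ 2 <= 1 by rewrite expr2; nra.
have th12 : th <= 1 / 2 by nra.
exists kap, th; split=> //; first by rewrite th0 /=; lra.
move=> E w m m0 hw.
have [F hF] := tort_as_orth E.
(* For the coefficients [- conj (w l)], the real part is minus the real inner product of [w] with
   the values of [x]; a very negative value is a strong correlation with [w]. *)
have [x [x1 xF hx]] := direction F (fun l => - ((w l)^*)%C).
have tm0 : 0 <= th * m by apply/ltW/mulr_gt0.
have hd : nsq ((Num.sqrt (th * m))%:C%C *: x) = th * m.
  by rewrite nsqZ x1 mulr1 normcR ger0_norm ?sqrtr_ge0 // sqr_sqrtr.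
have hV l : V ((Num.sqrt (th * m))%:C%C *: x) l = (th * m)%:C%C * V x l.
  rewrite /V (linZ (lin_iter l.+1)) ipZl ipZr conjc_real mulrA -(rmorphM (real_complex R)) /=.
  by rewrite -expr2 sqr_sqrtr.
exists ((Num.sqrt (th * m))%:C%C *: x); split=> //.
  by move=> y yE; apply/tortC/tortZ/tortC; exact: hF.
pose S := \sum_(l < k) Re (((w l)^*)%C * V x l).
have SE : Re (ip (opoly T k (fun l => - ((w l)^*)%C) x) x) = - S.
  rewrite /opoly ip_suml Re_sum -sumrN; apply: eq_bigr => l _.
  by rewrite ipZl mulNr ReN.
have hS l : (l < k)%N -> eta * normc (w l) <= S.
  by move=> /hx; rewrite SE (normcN (_^*)%C) normc_conjc lerN2.
have S0 : 0 <= S.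
  by apply: le_trans (hS 0%N k_gt0); rewrite mulr_ge0 ?normc_ge0 // ltW.
pose W := \sum_(l < k) normc (w l) ^+ 2.
have W0 : 0 <= W by apply: sumr_ge0 => l _; rewrite sqr_ge0.
pose t := Num.sqrt W; have t0 : 0 <= t by exact: sqrtr_ge0.
have tW : t ^+ 2 = W by rewrite sqr_sqrtr.
have tS : 2 * kap * t <= S.
  rewrite -(@ler_pXn2r _ 2) ?nnegrE ?mulr_ge0 // ?(ltW kap0) //.
  have h1 : eta ^+ 2 * W <= k%:R * S ^+ 2.
    rewrite /W mulr_sumr -[k in k%:R]card_ord -sum1_card natr_sum mulr_suml.
    apply: ler_sum => l _; rewrite mul1r -exprMn.
    by rewrite lerXn2r ?nnegrE ?mulr_ge0 ?normc_ge0 ?hS ?(ltW eta_gt0).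
  have k1 : 1 <= k%:R :> R by rewrite ler1n.
  have h2 : (2 * kap * k%:R) ^+ 2 <= eta ^+ 2.
    rewrite lerXn2r ?nnegrE ?mulr_ge0 ?(ltW kap0) ?(ltW eta_gt0) //; lra.
  rewrite exprMn tW.
  have h3 : (2 * kap * k%:R) ^+ 2 * W <= k%:R * S ^+ 2.
    by apply: le_trans h1; rewrite ler_wpM2r.
  have h4 : (2 * kap * k%:R) ^+ 2 * W = k%:R * (k%:R * ((2 * kap) ^+ 2 * W)) by ring.
  move: h3; rewrite h4 ler_pM2l // => h3.
  by apply: le_trans h3; rewrite ler_peMl // mulr_ge0 // sqr_ge0.
have -> : \sum_(l < k) normc (w l - V ((Num.sqrt (th * m))%:C%C *: x) l) ^+ 2 =
    W - 2 * (th * m) * S + (th * m) ^+ 2 * \sum_(l < k) normc (V x l) ^+ 2.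
  rewrite /W /S !mulr_sumr -sumrB -big_split /=; apply: eq_bigr => l _.
  rewrite hV !sqr_normc_Re_Im; case: (w l) => a b; case: (V x l) => c d /=; ring.
have hVx := hL x x1.
have tk : t <= kap * m.
  rewrite -(@ler_pXn2r _ 2) ?nnegrE ?mulr_ge0 // ?(ltW kap0) ?(ltW m0) //.
  by rewrite tW.
have hm := mulr_gt0 th0 m0.
apply: (@le_trans _ _ (t ^+ 2 - 2 * (th * m) * (2 * kap * t) + (th * m) ^+ 2 * L ^+ 2)).
  rewrite tW; apply: lerD; last by rewrite ler_wpM2l // sqr_ge0.
  by rewrite lerD2l lerN2 ler_wpM2l // mulr_ge0 // ltW.
have e1 : (th * m) ^+ 2 * L ^+ 2 = th * (kap * m) ^+ 2 / 2.
  have -> : (th * m) ^+ 2 * L ^+ 2 = th * (th * (2 * L ^+ 2)) * m ^+ 2 / 2 by field.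
  by rewrite thL; field.
rewrite e1.
have -> : t ^+ 2 - 2 * (th * m) * (2 * kap * t) = t * (t - 4 * th * (kap * m)) by ring.
have -> : kap * (m * (1 - th)) = (kap * m) * (1 - th) by ring.
move: (kap * m) (mulr_gt0 kap0 m0) tk => M M0 tM.
(* The new squared residual is at most [t (t - 4 th M) + th M^2 / 2]. For small [t] the first term
   is nonpositive and [th <= 1/2] suffices; otherwise it is largest at [t = M]. *)
have [le|lt] := leP t (4 * th * M).
  have : t * (t - 4 * th * M) <= 0 by rewrite mulr_ge0_le0 // subr_le0.
  have h0 : 0 <= M ^+ 2 * ((1 / 2 - th) * (2 - th)).
    by rewrite mulr_ge0 ?sqr_ge0 // mulr_ge0 //; lra.
  have : th * M ^+ 2 / 2 <= (M * (1 - th)) ^+ 2.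
    rewrite -subr_ge0.
    suff -> : (M * (1 - th)) ^+ 2 - th * M ^+ 2 / 2 = M ^+ 2 * ((1 / 2 - th) * (2 - th)) by [].
    by field.
  lra.
have : t * (t - 4 * th * M) <= M * (M - 4 * th * M).
  by apply: ler_pM => //; lra.
have := mulr_gt0 th0 (exprn_gt0 2 M0).
have -> : (M * (1 - th)) ^+ 2 =
    M * (M - 4 * th * M) + 2 * (th * M ^+ 2) + th ^+ 2 * M ^+ 2 by ring.
have := mulr_ge0 (sqr_ge0 th) (sqr_ge0 M).
lra.
Qed.

(** After [n] pieces the mass [q ^+ n] remains and the residual is at most [kap * q ^+ n]; both tend
    to 0, so the sum has norm 1 and exact values. The threshold [kap / k] makes the initial
    Euclidean residual at most [kap]. *)
Lemma prescribed_unit : exists2 kap : R, 0 < kap & forall E w,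
  (forall l, (l < k)%N -> normc (w l) <= kap) ->
  exists x, [/\ nsq x = 1, forall y, y \in E -> tort T k x y &
    forall l, (l < k)%N -> V x l = w l].
Proof.
have [kap [th [kap0 /andP[th0 th1] step]]] := greedy_constants.
have k0 : 0 < k%:R :> R by rewrite ltr0n.
exists (kap / k%:R); first exact: divr_gt0.
move=> E w hw.
pose q := 1 - th; have q0 : 0 < q by rewrite subr_gt0.
have q01 : 0 < q < 1 by rewrite q0 /q; lra.
pose res (s : seq H) l := w l - \sum_(d <- s) V d l.
pose inv s := \sum_(l < k) normc (res s l) ^+ 2 <= (kap * q ^+ size s) ^+ 2.
have [u hu] : exists u : nat -> H, forall n, inv (mkseq u n) ->
    [/\ forall y, y \in E ++ mkseq u n -> tort T k (u n) y,
        nsq (u n) = th * q ^+ n & inv (mkseq u n.+1)].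
  (* The choice must be possible after every list, so the conclusion is conditional on the
     invariant, which [inv_all] then supplies along the sequence. *)
  have [|u hu] := @dependent_choice_seq H (fun s d => inv s ->
      [/\ forall y, y \in E ++ s -> tort T k d y,
          nsq d = th * q ^+ size s & inv (rcons s d)]).
    move=> s; have [is_|nis] := pselect (inv s); last by exists 0.
    have [d [d1 d2 d3]] := step (E ++ s) _ _ (exprn_gt0 (size s) q0) is_.
    exists d => _; split=> //; rewrite /inv size_rcons (exprSr q).
    apply: le_trans d3; rewrite le_eqVlt; apply/orP; left; apply/eqP.
    by apply: eq_bigr => l _; rewrite /res -cats1 big_cat big_seq1 opprD addrA.
  by exists u => n /hu; rewrite size_mkseq mkseqS.
have inv_all n : inv (mkseq u n).
  elim: n => [|n /hu[]//]; rewrite /inv /= expr0 mulr1.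
  apply: (@le_trans _ _ (\sum_(l < k) (kap / k%:R) ^+ 2)).
    apply: ler_sum => l _; rewrite /res big_nil subr0.
    by rewrite lerXn2r ?nnegrE ?normc_ge0 ?hw // divr_ge0 // ltW.
  rewrite sumr_const card_ord -[_ *+ k]mulr_natr expr_div_n.
  have k1 : 1 <= k%:R :> R by rewrite ler1n.
  have -> : kap ^+ 2 / k%:R ^+ 2 * k%:R = kap ^+ 2 / k%:R by field; rewrite gt_eqF.
  by rewrite ler_pdivrMr // ler_peMr // sqr_ge0.
have ut n y : y \in E ++ mkseq u n -> tort T k (u n) y.
  by case: (hu n (inv_all n)) => h _ _; exact: h.
have un n : nsq (u n) = th * q ^+ n by case: (hu n (inv_all n)).
have uu i j : i != j -> tort T k (u i) (u j).
  wlog ij : i j / (j < i)%N.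
    move=> h; case: (ltngtP i j) => [ij _|ij _|//].
      by apply/tortC/h; rewrite // gtn_eqF.
    by apply: h; rewrite // gtn_eqF.
  by move=> _; apply: ut; rewrite mem_cat (map_f u) ?orbT // mem_iota.
pose S n := \sum_(i < n) u i.
have SS n p : nsq (S (n + p)%N - S n) = q ^+ n - q ^+ (n + p).
  elim: p => [|p IH]; first by rewrite addn0 !subrr nsq0.
  rewrite addnS /S big_ord_recr /= -/(S (n + p)%N) addrAC nsq_pyth.
    by rewrite IH un exprS /q; ring.
  have tS m : (m <= n + p)%N -> tort T k (u (n + p)%N) (S m).
    move=> mn; apply: tort_sum => i _; apply: uu.
    by rewrite gtn_eqF // (leq_trans (ltn_ord i)).
  have [_ h1] := tS _ (leqnn _) 0%N isT; have [_ h2] := tS _ (leq_addr p n) 0%N isT.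
  by rewrite ipBl /= in h1 h2 *; rewrite h1 h2 subrr.
have [x Sx] : exists x, tends S x.
  apply: ip_complete => e e0; have [N hN] := geometric_small q01 e0.
  exists N; suff h m n : (N <= m)%N -> (m <= n)%N -> nsq (S n - S m) <= e.
    move=> m n Nm Nn; have [mn|/ltnW nm] := leqP m n; last exact: h.
    by rewrite nsqBC; exact: h.
  move=> Nm mn; rewrite -(subnKC mn) SS.
  apply: le_trans (hN m Nm); rewrite gerDl oppr_le0.
  by apply: exprn_ge0; exact: ltW.
have ipS l n : (l <= k)%N ->
    ip (iter l T (S n)) (S n) = \sum_(i < n) ip (iter l T (u i)) (u i).
  move=> lk; have := @ip_tort_sum l n u (fun=> 1) (fun=> 1) lk (fun i j _ _ => @uu i j).
  rewrite /S; under eq_bigr do rewrite scale1r.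
  by move=> ->; apply: eq_bigr => i _; rewrite conjc1 !mul1r.
exists x; split.
- suff h : ip x x = 1 by rewrite /nsq h.
  apply: (ip_lim Sx Sx) => e e0; have [N hN] := geometric_small q01 e0.
  exists N => n /hN hn; rewrite ipxx -(rmorph1 (real_complex R)) -rmorphB normcR.
  have := SS 0%N n; rewrite /S big_ord0 subr0 add0n expr0 => ->.
  by rewrite addrAC subrr add0r normrN ger0_norm // exprn_ge0 // ltW.
- move=> y yE; apply: (tort_tends Sx) => n.
  by apply/tortC/tort_sum => i _; apply/tortC/ut; rewrite mem_cat yE.
- move=> l lk; apply: (ip_lim (tends_bop (bop_iter l.+1 bT) Sx) Sx) => e e0.
  have [N hN] := geometric_small q01 (divr_gt0 e0 kap0).
  exists N => n /hN; rewrite ler_pdivlMr // mulrC => hn.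
  apply: le_trans hn; rewrite [_ \o _]/= ipS //.
  have := inv_all n; rewrite /inv size_mkseq => h.
  have kq : 0 <= kap * q ^+ n by rewrite mulr_ge0 ?exprn_ge0 ?(ltW q0) ?(ltW kap0).
  rewrite -(@ler_pXn2r _ 2) ?nnegrE ?normc_ge0 //.
  have resE : res (mkseq u n) l = w l - \sum_(i < n) V (u i) l.
    by rewrite /res big_map -(big_mkord xpredT (fun i => V (u i) l)) /index_iota subn0.
  apply: le_trans h; rewrite (bigD1 (Ordinal lk)) //= resE -(normcN (_ - _)) opprB.
  by rewrite lerDl sumr_ge0 // => i _; rewrite sqr_ge0.
Qed.

End Greedy.
End PrescribedCompression.

(** * Prescribed finite arrays *)

Lemma iter_form_bounded (R : realType) (H : hilbert R) (T : H -> H) k : bop T ->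
  exists2 L : R, 0 < L &
    forall (x : H) l, (l < k)%N -> normc (ip (iter l.+1 T x) x) <= L * nsq x.
Proof.
move=> bT; have /choice[K hK] : forall l : nat, exists K : R, 0 < K /\
    forall x : H, hn (iter l.+1 T x) <= K * hn x.
  by move=> l; have [_ [K K0 hK]] := bop_iter l.+1 bT; exists K.
have K0 l : 0 < K l by have [] := hK l.
exists (\sum_(l < k) K l + 1).
  by rewrite ltr_wpDl // sumr_ge0 // => l _; rewrite ltW.
move=> x l lk; apply: le_trans (cauchy_schwarz _ _) _.
rewrite -hn2 expr2 mulrA ler_wpM2r ?hn_ge0 //.
have [_ h] := hK l; apply: le_trans (h x) _; rewrite ler_wpM2r ?hn_ge0 //.
rewrite (bigD1 (Ordinal lk)) //= -addrA lerDl addr_ge0 // sumr_ge0 // => i _.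
exact: ltW.
Qed.

Section Compressions.
Variables (R : realType) (H : hilbert R) (T : H -> H) (k : nat).
Hypothesis bT : bop T.
Hypothesis k_gt0 : (0 < k)%N.
Implicit Types (x y z : H) (E F : seq H) (w : nat -> R[i]).

(** Taking for [l0] a coordinate of maximal modulus makes one inequality serve all coordinates. If
    [w] vanishes, only a unit vector orthogonal to [F] is needed, and the direction with all
    coefficients 1 provides one. *)
Lemma numerical_range_direction_all (r0 : R) : 0 < r0 ->
  (forall (z : R[i]), normc z < r0 -> forall (q : {poly R[i]}) (b : R),
    (forall s : R[i], ~ binv (fun x => T x - s *: x) -> normc q.[s] <= b) ->
    normc q.[z] <= b) ->
  exists2 eta : R, 0 < eta & forall F w, exists x, [/\ nsq x = 1,
    forall y, y \in F -> ip x y = 0 &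
    forall l, (l < k)%N -> Re (ip (opoly T k w x) x) <= - (eta * normc (w l))].
Proof.
move=> r00 hull; pose r := Num.min 1 (r0 / 2).
have rgt0 : 0 < r by rewrite lt_min ltr01 divr_gt0.
have r1 : r <= 1 by rewrite ge_min lexx.
have rr : 2 * r <= r0 by rewrite mulrC -ler_pdivlMr // ge_min lexx orbT.
exists (r ^+ k / 16); first by rewrite divr_gt0 // exprn_gt0.
move=> F w.
pose i0 := Ordinal k_gt0.
pose l0 := [arg max_(i > i0) normc (w (i : 'I_k))]%O.
have hl0 l : (l < k)%N -> normc (w l) <= normc (w l0).
  by move=> lk; rewrite /l0; case: arg_maxP => // i _ /(_ (Ordinal lk) isT).
have [w0|wnz] := eqVneq (w l0) 0; last first.
  have [x [x1 xF hx]] := @numerical_range_direction R H T bT r0 hull k F w l0 r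
    rgt0 r1 rr (ltn_ord _) wnz.
  exists x; split=> // l lk; apply: le_trans hx _; rewrite lerN2.
  by rewrite ler_wpM2l ?hl0 // divr_ge0 // exprn_ge0 // ltW.
have [x [x1 xF _]] := @numerical_range_direction R H T bT r0 hull k F (fun=> 1) 0 r
    rgt0 r1 rr k_gt0 (oner_neq0 _).
have wl l : (l < k)%N -> w l = 0.
  move=> lk; apply/eqP; rewrite -normc_eq0; apply/eqP/le_anti.
  by rewrite normc_ge0 andbT; have := hl0 l lk; rewrite w0 Normc.normc0.
exists x; split=> // l lk.
rewrite wl // Normc.normc0 mulr0 oppr0 /opoly big1 ?ip0l // => i _.
by rewrite wl // scale0r.
Qed.

Let lin_iter l : linear (iter l T). Proof. by have [] := bop_iter l bT. Qed.

Variable kap : R.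
Hypothesis kap_gt0 : 0 < kap.
Hypothesis unit_compression : forall E w,
  (forall l, (l < k)%N -> normc (w l) <= kap) ->
  exists x, [/\ nsq x = 1, forall y, y \in E -> tort T k x y &
    forall l, (l < k)%N -> ip (iter l.+1 T x) x = w l].

Lemma prescribed_compression E w (mu : R) : 0 <= mu ->
  (forall l, (l < k)%N -> normc (w l) <= kap * mu) ->
  exists x, [/\ nsq x = mu, forall y, y \in E -> tort T k x y &
    forall l, (l < k)%N -> ip (iter l.+1 T x) x = w l].
Proof.
rewrite le_eqVlt => /orP[/eqP <- hw|mu0 hw].
  exists 0; split; first exact: nsq0.
    by move=> y _; apply: tortC; exact: tort0.
  move=> l lk; rewrite ip0r; apply/esym/eqP; rewrite -normc_eq0; apply/eqP/le_anti.
  by rewrite normc_ge0 andbT -[leRHS](mulr0 kap) hw.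
have [|x [x1 xE hx]] := unit_compression E (w := fun l => (mu^-1)%:C%C * w l).
  move=> l lk; rewrite Normc.normcM normcR ger0_norm ?invr_ge0 ?(ltW mu0) //.
  by rewrite mulrC ler_pdivrMr // hw.
exists ((Num.sqrt mu)%:C%C *: x); split.
- by rewrite nsqZ x1 mulr1 normcR ger0_norm ?sqrtr_ge0 // sqr_sqrtr // ltW.
- by move=> y yE; apply/tortC/(tortZ bT)/tortC; exact: xE.
- move=> l lk; rewrite (linZ (lin_iter l.+1)) ipZl ipZr conjc_real hx //.
  rewrite !mulrA -!(rmorphM (real_complex R)) /= -expr2 sqr_sqrtr ?(ltW mu0) //.
  by rewrite mulfV ?mul1r // gt_eqF.
Qed.

Lemma prescribed_family E (mu : nat -> R) (w : nat -> nat -> R[i]) :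
  (forall i, 0 <= mu i) ->
  (forall i l, (l < k)%N -> normc (w i l) <= kap * mu i) ->
  exists x : nat -> H, [/\ forall i, nsq (x i) = mu i,
    forall i y, y \in E -> tort T k (x i) y,
    forall i j, i != j -> tort T k (x i) (x j) &
    forall i l, (l < k)%N -> ip (iter l.+1 T (x i)) (x i) = w i l].
Proof.
move=> mu0 hw.
have [|x hx] := @dependent_choice_seq H (fun s x =>
  [/\ nsq x = mu (size s), forall y, y \in E ++ s -> tort T k x y &
    forall l, (l < k)%N -> ip (iter l.+1 T x) x = w (size s) l]).
  by move=> s; apply: prescribed_compression => //; exact: hw.
exists x; split.
- by move=> i; have [] := hx i; rewrite size_mkseq.
- by move=> i y yE; have [_ h _] := hx i; apply: h; rewrite mem_cat yE.
- move=> i j; wlog ij : i j / (j < i)%N.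
    move=> h; case: (ltngtP i j) => [ij _|ij _|//].
      by apply/tortC/h; rewrite // gtn_eqF.
    by apply: h; rewrite // gtn_eqF.
  move=> _; have [_ h _] := hx i; apply: h.
  by rewrite mem_cat (map_f x) ?orbT // mem_iota.
- by move=> i l lk; have [_ _ h] := hx i; rewrite h ?size_mkseq.
Qed.

(* Polarization: with [p = sum_s 'i^s x_s] and [q = sum_s x_s], the number
   [<T^l p, q>] is [sum_s 'i^s <T^l x_s, x_s>]. *)
Lemma prescribed_pair E (mu : R) (b c : nat -> R[i]) : 0 <= mu ->
  (forall l, (l < k)%N -> normc (b l) + normc (c l) <= kap * mu) ->
  exists p q, [/\ forall y, y \in E -> tort T k p y /\ tort T k q y,
    nsq p = mu /\ nsq q = mu, ip p q = 0 &
    forall l, (l < k)%N ->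
      [/\ ip (iter l.+1 T p) q = b l, ip (iter l.+1 T q) p = c l,
        ip (iter l.+1 T p) p = 0 & ip (iter l.+1 T q) q = 0]].
Proof.
move=> mu0 hbc.
have [i1 [ii iJ ni]] : exists i1 : R[i],
    [/\ i1 * i1 = -1, (i1^*)%C = - i1 & normc (- i1) = 1].
  exists 'i%C; split; first by rewrite -expr2 sqr_i.
    by apply/complexP; rewrite /= ?oppr0.
  by rewrite (normcN 'i%C) /= expr0n expr1n add0r sqrtr1.
(* The values [e, d, -e, -d] sum to 0, which kills both diagonal forms; weighted by the powers of
   ['i] and by their conjugates they sum to [2 e + 2 'i d = b] and [2 e - 2 'i d = c]. *)
pose e l := (b l + c l) / 4; pose d l := - i1 * (b l - c l) / 4.
pose w s l := nth 0 [:: e l; d l; - e l; - d l] s.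
pose a s := nth 0 [:: 1; i1; -1; - i1] s.
have aE : (a 0%N = 1) * (a 1%N = i1) * (a 2%N = -1) * (a 3%N = - i1) by [].
have wE l : (w 0%N l = e l) * (w 1%N l = d l) * (w 2%N l = - e l) * (w 3%N l = - d l) by [].
have n4 : normc (4 : R[i]) = 4.
  by rewrite -(rmorph_nat (real_complex R)) normcR ger0_norm.
have hw s l : (l < k)%N -> normc (w s l) <= kap * (mu / 4).
  move=> lk; have h := hbc l lk.
  have km : 0 <= kap * (mu / 4) by rewrite mulr_ge0 ?divr_ge0 ?(ltW kap_gt0).
  have he : normc (e l) <= kap * (mu / 4).
    rewrite /e Normc.normcM Normc.normcV n4 mulrA ler_pM2r ?invr_gt0 //.
    exact: le_trans (normcD _ _) h.
  have hd : normc (d l) <= kap * (mu / 4).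
    rewrite /d !Normc.normcM Normc.normcV n4 ni mul1r mulrA ler_pM2r ?invr_gt0 //.
    exact: le_trans (normcB _ _) h.
  rewrite /w; case: s => [//|[//|[|[|s]]]] /=.
  - by rewrite (normcN (e l)).
  - by rewrite (normcN (d l)).
  - by rewrite nth_nil Normc.normc0.
have m4 : 0 <= mu / 4 by exact: divr_ge0.
have [x [x1 xE xx xw]] := prescribed_family E (fun=> m4) hw.
have ipx l (u v : nat -> R[i]) : (l <= k)%N ->
    ip (iter l T (\sum_(s < 4) u s *: x s)) (\sum_(s < 4) v s *: x s) =
    u 0%N * ((v 0%N)^*)%C * ip (iter l T (x 0%N)) (x 0%N) +
    u 1%N * ((v 1%N)^*)%C * ip (iter l T (x 1%N)) (x 1%N) +
    u 2%N * ((v 2%N)^*)%C * ip (iter l T (x 2%N)) (x 2%N) +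
    u 3%N * ((v 3%N)^*)%C * ip (iter l T (x 3%N)) (x 3%N).
  move=> lk; rewrite (@ip_tort_sum R H T k) //; last by move=> i j _ _ ij; exact: xx.
  by rewrite !big_ord_recr big_ord0 /= add0r.
have ip0 (u v : nat -> R[i]) :
    ip (\sum_(s < 4) u s *: x s) (\sum_(s < 4) v s *: x s) =
    (u 0%N * ((v 0%N)^*)%C + u 1%N * ((v 1%N)^*)%C + u 2%N * ((v 2%N)^*)%C
      + u 3%N * ((v 3%N)^*)%C) * (mu / 4)%:C%C.
  by have := ipx 0%N u v isT; rewrite !ipxx !x1 => ->; rewrite !mulrDl.
have N1 : ((-1 : R[i])^*)%C = -1 by apply/complexP; rewrite /= ?oppr0.
have Ni : ((- i1)^*)%C = i1 by rewrite -mulN1r conjcM N1 iJ mulN1r opprK.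
have m44 : (4 : R[i]) * (mu / 4)%:C%C = mu%:C%C.
  by rewrite -(rmorph_nat (real_complex R)) -rmorphM; congr (_%:C)%C; field.
exists (\sum_(s < 4) a s *: x s), (\sum_(s < 4) 1 *: x s); split.
- move=> y yE; split; apply: tortC; apply: (tort_sum bT) => s _;
    by apply/(tortZ bT)/tortC; exact: xE.
- rewrite /nsq (ip0 a a) (ip0 (fun=> 1) (fun=> 1)) !aE !conjc1 N1 iJ Ni.
  have -> : 1 * 1 + i1 * - i1 + -1 * -1 + - i1 * i1 = 4 - 2 * (i1 * i1 + 1) by ring.
  have -> : 1 * 1 + 1 * 1 + 1 * 1 + 1 * 1 = 4 :> R[i] by ring.
  by rewrite ii addNr mulr0 subr0 m44.
- rewrite (ip0 a (fun=> 1)) !aE !conjc1.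
  by rewrite (_ : _ + _ = 0) ?mul0r //; ring.
- move=> l lk; rewrite !(ipx l.+1 a (fun=> 1)) // (ipx l.+1 (fun=> 1) a) //.
  rewrite (ipx l.+1 a a) // (ipx l.+1 (fun=> 1) (fun=> 1)) //.
  rewrite !aE !conjc1 N1 iJ Ni !xw // !wE /e /d.
  split.
  - have -> : 1 * 1 * ((b l + c l) / 4) + i1 * 1 * (- i1 * (b l - c l) / 4)
      + -1 * 1 * - ((b l + c l) / 4) + - i1 * 1 * - (- i1 * (b l - c l) / 4)
      = (b l + c l) / 2 - (i1 * i1) * ((b l - c l) / 2) by field.
    by rewrite ii; field.
  - have -> : 1 * 1 * ((b l + c l) / 4) + 1 * - i1 * (- i1 * (b l - c l) / 4)
      + 1 * -1 * - ((b l + c l) / 4) + 1 * i1 * - (- i1 * (b l - c l) / 4)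
      = (b l + c l) / 2 + (i1 * i1) * ((b l - c l) / 2) by field.
    by rewrite ii; field.
  - ring.
  - ring.
Qed.

(* One step of the construction of the basis: [g] starts a new basis vector and
   [e j] is added to the older vector of index [j < n]. *)
Lemma prescribed_arrow E n (t : nat -> R) (b c : nat -> nat -> R[i]) (mu : R) w :
  (forall j, 0 <= t j) ->
  (forall j l, (l < k)%N -> normc (b j l) + normc (c j l) <= kap * t j) ->
  0 <= mu -> (forall l, (l < k)%N -> normc (w l) <= kap * mu) ->
  exists (e : nat -> H) g, [/\
    (forall y, y \in E -> tort T k g y) /\
      (nsq g = mu + \sum_(j < n) t j /\
       forall l, (l < k)%N -> ip (iter l.+1 T g) g = w l),
    forall j, (j < n)%N -> forall y, y \in E -> tort T k (e j) y,
    forall i j, (i < n)%N -> (j < n)%N -> i != j -> tort T k (e i) (e j) &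
    forall j, (j < n)%N -> [/\ nsq (e j) = t j, ip (e j) g = 0 &
      forall l, (l < k)%N ->
        [/\ ip (iter l.+1 T (e j)) g = b j l, ip (iter l.+1 T g) (e j) = c j l &
          ip (iter l.+1 T (e j)) (e j) = 0]]].
Proof.
move=> t0 hbc mu0 hw; elim: n => [|n [e [g [[gE [gn gw]] eE ee eg]]]].
  have [x [x1 xE xw]] := prescribed_compression E mu0 hw.
  by exists (fun=> 0), x; split=> //; rewrite big_ord0 addr0.
have [p [q [pqE [pn qn] pq pqT]]] := prescribed_pair (E ++ g :: mkseq e n) (t0 n) (hbc n).
have pqe j : (j < n)%N -> tort T k p (e j) /\ tort T k q (e j).
  by move=> jn; apply: pqE; rewrite mem_cat inE (map_f e) ?orbT // mem_iota.
have [pg qg] : tort T k p g /\ tort T k q g.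
  by apply: pqE; rewrite mem_cat inE eqxx orbT.
have pqE' y : y \in E -> tort T k p y /\ tort T k q y.
  by move=> yE; apply: pqE; rewrite mem_cat yE.
exists (fun j => if j == n then p else e j), (g + q); split.
- split=> [y yE|].
    by apply/tortC/(tortD bT); apply/tortC; [exact: gE|case: (pqE' y yE)].
  split.
    rewrite nsq_pyth; first by rewrite gn qn big_ord_recr /= addrA.
    by have [_] := qg 0%N isT.
  move=> l lk; rewrite (linD (lin_iter l.+1)) ipDl !ipDr gw //.
  have [h1 h2] := qg l.+1 lk; have [_ _ _ h3] := pqT l lk.
  by rewrite h1 h2 h3 !addr0.
- move=> j; rewrite ltnS leq_eqVlt; case: eqVneq => [_ _ y /pqE' []//|_ /= jn y].
  exact: eE.
- move=> i j; rewrite !ltnS (leq_eqVlt i) (leq_eqVlt j).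
  case: (eqVneq i n) => [->|ni]; case: (eqVneq j n) => [->|nj] /=.
  + by [].
  + by move=> _ jn _; have [] := pqe j jn.
  + by move=> jn _ _; apply: tortC; have [] := pqe i jn.
  + by move=> hi hj hij; exact: ee.
- move=> j; rewrite ltnS leq_eqVlt; case: eqVneq => [-> _|_ /= jn].
    split=> //; first by rewrite ipDr pq addr0; have [] := pg 0%N isT.
    move=> l lk; have [h1 h2] := pg l.+1 lk; have [h3 h4 h5 _] := pqT l lk.
    by rewrite ipDr h1 add0r (linD (lin_iter l.+1)) ipDl h2 add0r.
  have [h1 h2 h3] := eg j jn; have [_ qe] := pqe j jn.
  split=> //; first by rewrite ipDr h2 add0r; have [_ /= ->] := qe 0%N isT.
  move=> l lk; have [h4 h5 h6] := h3 l lk; have [h7 h8] := qe l.+1 lk.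
  by rewrite -!(iterS _ T) ipDr h8 addr0 (linD (lin_iter l.+1)) ipDl h7 addr0.
Qed.

End Compressions.

(** * Inductive construction of the basis *)

Lemma bounded_series (R : realType) (f : nat -> R) (b : R) :
  (forall n, 0 <= f n) -> (forall m, \sum_(n < m) f n <= b) ->
  exists s, [/\ s <= b, forall m, \sum_(n < m) f n <= s &
    forall e, 0 < e -> exists N, forall m, (N <= m)%N -> s - \sum_(n < m) f n <= e].
Proof.
move=> f0 fb; pose D := [set \sum_(n < m) f n | m in [set: nat]]%classic.
have hD : has_sup D.
  by split; [exists (\sum_(n < 0) f n), 0%N|exists b => _ [m _ <-]].
have mono m p : \sum_(n < m) f n <= \sum_(n < m + p) f n.
  elim: p => [|p IH]; first by rewrite addn0.
  by rewrite addnS big_ord_recr /=; apply: le_trans IH _; rewrite lerDl.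
exists (sup D); split.
- by apply: ge_sup => [|_ [m _ <-]]; [exact: hD.1|exact: fb].
- by move=> m; apply: (ub_le_sup hD.2); exists m.
- move=> e e0; have [_ [N _ <-] lt] := sup_adherent e0 hD.
  by exists N => m Nm; have := mono N (m - N)%N; rewrite subnKC //; lra.
Qed.

Section BasisConstruction.
Variables (R : realType) (H : hilbert R) (T : H -> H) (k : nat).
Hypothesis bT : bop T.
Implicit Types (x y z : H).

Let lin_iter l : linear (iter l T). Proof. by have [] := bop_iter l bT. Qed.

Variables (kap L : R) (aa : nat -> nat -> nat -> R[i]) (A : nat -> nat -> R).
Hypothesis kap_gt0 : 0 < kap.
Hypothesis arrow : forall (E : seq H) n (t : nat -> R) (b c : nat -> nat -> R[i])
    (mu : R) (w : nat -> R[i]),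
  (forall j, 0 <= t j) ->
  (forall j l, (l < k)%N -> normc (b j l) + normc (c j l) <= kap * t j) ->
  0 <= mu -> (forall l, (l < k)%N -> normc (w l) <= kap * mu) ->
  exists (e : nat -> H) g, [/\
    (forall y, y \in E -> tort T k g y) /\
      (nsq g = mu + \sum_(j < n) t j /\
       forall l, (l < k)%N -> ip (iter l.+1 T g) g = w l),
    forall j, (j < n)%N -> forall y, y \in E -> tort T k (e j) y,
    forall i j, (i < n)%N -> (j < n)%N -> i != j -> tort T k (e i) (e j) &
    forall j, (j < n)%N -> [/\ nsq (e j) = t j, ip (e j) g = 0 &
      forall l, (l < k)%N ->
        [/\ ip (iter l.+1 T (e j)) g = b j l, ip (iter l.+1 T g) (e j) = c j l &
          ip (iter l.+1 T (e j)) (e j) = 0]]].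
Hypothesis L_gt0 : 0 < L.
Hypothesis T_le : forall x l, (l < k)%N -> normc (ip (iter l.+1 T x) x) <= L * nsq x.
Hypothesis A_ge0 : forall i j, 0 <= A i j.
Hypothesis aa_le : forall i j l, (l < k)%N -> normc (aa i j l) <= A i j.
Hypothesis A_row : forall i m, \sum_(j < m) A i j <= kap / 8.
Hypothesis A_col : forall j m, \sum_(i < m) A i j <= kap / 8.

(* At step [n] the target [Y n] is approximated: [u_n] gets a multiple of the
   part of [Y n] orthogonal to the vectors of index [< prv n], to which it is
   not linked. *)
Variables (link : nat -> nat -> Prop) (prv : nat -> nat) (Y y : nat -> H).
Hypothesis prv_le : forall n, (prv n <= n)%N.
Hypothesis prv_free : forall n j, (j < prv n)%N -> ~ link j n /\ ~ link n j.
Hypothesis Y_apart : forall n m, (n < m)%N -> (prv m <= n)%N -> Y n = 0 \/ Y m = 0.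
Hypothesis Y_target : forall n, exists2 t, (t <= prv n)%N & Y n = y t.
Hypothesis y_le1 : forall t, nsq (y t) <= 1.
Hypothesis y_often : forall t m, exists n, (m <= prv n)%N /\ Y n = y t.
Hypothesis y_dense : forall x (e : R), 0 < e -> nsq x = 1 / 4 ->
  exists t, nsq (y t - x) <= e.

(** Mass of the pieces serving the pair [{i, j}], spent at step [max i j]: mass [t] reaches values
    up to [kap * t]. *)
Let tau i j : R := if i == j then 0 else (A i j + A j i) / kap.

Let tau_ge0 i j : 0 <= tau i j.
Proof. by rewrite /tau; case: eqP => // _; rewrite divr_ge0 ?addr_ge0 // ltW. Qed.

Let tauC i j : tau i j = tau j i.
Proof. by rewrite /tau eq_sym addrC. Qed.

Lemma tau_tail : exists s : nat -> R, [/\ forall j, s j <= 1 / 4,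
  forall j m, \sum_(n < m) tau j n <= s j &
  forall j e, 0 < e -> exists N, forall m, (N <= m)%N -> s j - \sum_(n < m) tau j n <= e].
Proof.
have /choice[s hs] : forall j, exists s, [/\ s <= 1 / 4,
    forall m, \sum_(n < m) tau j n <= s &
    forall e, 0 < e -> exists N, forall m, (N <= m)%N -> s - \sum_(n < m) tau j n <= e].
  move=> j; apply: bounded_series => // m.
  apply: (@le_trans _ _ (\sum_(n < m) (A j n + A n j) / kap)).
    apply: ler_sum => n _; rewrite /tau; case: eqP => // _.
    by rewrite divr_ge0 ?addr_ge0 // ltW.
  rewrite -mulr_suml ler_pdivrMr // big_split /=.
  by have := A_row j m; have := A_col j m; lra.
by exists s; split=> j; have [] := hs j.
Qed.

(** With [nsq z <= c0 ^+ 2 <= 1/4] and [s n <= 1/4], half of the mass of [u_n] is left for the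
    diagonal. That half reaches [kap / 2], while the value required is at most [kap / 8] from the
    array plus [L * c0 ^+ 2 <= kap / 8] to compensate [z]. *)
Let c0 : R := Num.min (1 / 2) (kap / (8 * L)).

Let c0_gt0 : 0 < c0.
Proof. by rewrite lt_min divr_gt0 // divr_gt0 // mulr_gt0. Qed.

Let c0_le : c0 ^+ 2 <= 1 / 4 /\ L * c0 ^+ 2 <= kap / 8.
Proof.
have h1 : c0 <= 1 / 2 by rewrite ge_min lexx.
have h2 : c0 * (8 * L) <= kap.
  by rewrite -ler_pdivlMr ?mulr_gt0 // ge_min lexx orbT.
have h0 := c0_gt0; have hL := L_gt0.
split; first by rewrite expr2; nra.
have : c0 * L * c0 <= c0 * L * 1 by rewrite ler_wpM2l ?mulr_ge0 ?(ltW h0) ?(ltW hL) //; lra.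
rewrite expr2; lra.
Qed.

Let U (d : nat -> nat -> H) m j : H := \sum_(n < m) d n j.

Let xi (d : nat -> nat -> H) n : H :=
  Y n - \sum_(j < prv n) (ip (Y n) (U d (prv n) j) / (nsq (U d (prv n) j))%:C%C)
          *: U d (prv n) j.

(* [dn j] is what step [n] adds to [u_j], and [z] the part of [u_n] chosen in
   advance: [new] removes [z] from it. *)
Let new (dn : nat -> H) n z j : H := if j == n then dn n - z else dn j.

(** The mass of the new piece is such that, together with [z], [u_n] has [1 - s n] plus the masses
    of the links just made: the reserve [s n] covers all links of [n], and those with [j < n] are
    spent at once. *)
Let good (s : nat -> R) (d : nat -> nat -> H) n (dn : nat -> H) z : Prop :=
  [/\ forall j, (n < j)%N -> dn j = 0,
   forall j, (j <= n)%N ->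
     (forall i i', (i < n)%N -> (i' < n)%N -> tort T k (new dn n z j) (d i i')) /\
     (forall t, (t <= n)%N -> tort T k (new dn n z j) (y t)),
   nsq (new dn n z n) = 1 - nsq z - s n + \sum_(j < n) tau j n /\
     (forall l, (l < k)%N -> ip (iter l.+1 T (new dn n z n)) (new dn n z n) =
        aa n n l - ip (iter l.+1 T z) z),
   forall i j, (i < n)%N -> (j < n)%N -> i != j ->
     tort T k (new dn n z i) (new dn n z j) &
   forall j, (j < n)%N -> [/\ nsq (new dn n z j) = tau j n,
     ip (new dn n z j) (new dn n z n) = 0 &
     forall l, (l < k)%N ->
       [/\ ip (iter l.+1 T (new dn n z j)) (new dn n z n) = aa n j l,
           ip (iter l.+1 T (new dn n z n)) (new dn n z j) = aa j n l &
           ip (iter l.+1 T (new dn n z j)) (new dn n z j) = 0]]].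

Lemma good_step (s : nat -> R) (d : nat -> nat -> H) n : (forall j, s j <= 1 / 4) ->
  exists (dn : nat -> H) z, z = c0%:C%C *: xi d n /\
    (nsq z <= c0 ^+ 2 -> good s d n dn z).
Proof.
move=> s4; pose z := c0%:C%C *: xi d n.
have [nz|nz] := leP (nsq z) (c0 ^+ 2); last first.
  by exists (fun=> 0), z; split=> //; rewrite leNgt nz.
have [c1 c2] := c0_le.
pose E := [seq d i i' | i <- iota 0 n, i' <- iota 0 n] ++ mkseq y n.+1.
have s4n := s4 n.
have [||||e [g [[gE [gn gw]] eE ee eg]]] :=
  @arrow E n (fun j => tau j n) (fun j l => if j == n then 0 else aa n j l)
   (* [arrow] asks its bound for every [j]; at [j = n] the mass [tau n n] is 0, so the value must be
      0 there. The diagonal is handled by the last argument. *)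
   (fun j l => if j == n then 0 else aa j n l)
   (1 - nsq z - s n) (fun l => aa n n l - ip (iter l.+1 T z) z).
- by [].
- move=> j l lk; rewrite /tau; case: eqP => [_|_].
    by rewrite Normc.normc0 addr0 mulr0.
  by rewrite mulrC divfK ?gt_eqF // addrC lerD // aa_le.
- by lra.
- move=> l lk; apply: le_trans (normcB _ _) _.
  have h1 : A n n <= kap / 8.
    have := A_row n n.+1; rewrite big_ord_recr /=; apply: le_trans.
    by rewrite lerDr sumr_ge0.
  have h2 := aa_le n n lk; have h3 := T_le z lk.
  have h4 := ler_wpM2l (ltW L_gt0) nz.
  have h5 : kap * (1 / 2) <= kap * (1 - nsq z - s n).
    by rewrite ler_wpM2l ?(ltW kap_gt0) //; lra.
  by have := kap_gt0; lra.
pose dn j := if j == n then g + z else if (j < n)%N then e j else 0.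
have newn : new dn n z n = g by rewrite /new /dn !eqxx addrK.
have newj j : (j < n)%N -> new dn n z j = e j.
  by move=> jn; rewrite /new /dn (ltn_eqF jn) jn.
have inE1 i i' : (i < n)%N -> (i' < n)%N -> d i i' \in E.
  by move=> hi hi'; rewrite mem_cat (allpairs_f d) // mem_iota.
have inE2 t : (t <= n)%N -> y t \in E.
  by move=> tn; rewrite mem_cat (map_f y) ?orbT // mem_iota.
exists dn, z; split=> // _; split.
- by move=> j nj; rewrite /dn (gtn_eqF nj) ltnNge (ltnW nj).
- move=> j; rewrite leq_eqVlt => /orP[/eqP ->|jn].
    by rewrite newn; split=> *; apply: gE; [exact: inE1|exact: inE2].
  by rewrite newj //; split=> *; apply: eE => //; [exact: inE1|exact: inE2].
- by rewrite newn.
- by move=> i j hi hj; rewrite !newj //; exact: ee.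
- move=> j jn; rewrite newn newj //; have [h1 h2 h3] := eg j jn.
  by split=> // l lk; have := h3 l lk; rewrite (ltn_eqF jn).
Qed.

Lemma construction : exists (s : nat -> R) (d : nat -> nat -> H) (z : nat -> H),
  [/\ forall j, s j <= 1 / 4,
   forall j m, \sum_(n < m) tau j n <= s j,
   forall j e, 0 < e -> exists N, forall m, (N <= m)%N -> s j - \sum_(n < m) tau j n <= e &
   forall n, z n = c0%:C%C *: xi d n /\ (nsq (z n) <= c0 ^+ 2 -> good s d n (d n) (z n))].
Proof.
have [s [s4 sum_s s_lim]] := tau_tail.
pose p0 : (nat -> H) * H := (fun=> 0, 0).
have [|u hu] := @dependent_choice_seq ((nat -> H) * H) (fun h p =>
  let d i j := (nth p0 h i).1 j in
  p.2 = c0%:C%C *: xi d (size h) /\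
  (nsq p.2 <= c0 ^+ 2 -> good s d (size h) p.1 p.2)).
  move=> h; have [dn [z [h1 h2]]] := good_step (fun i j => (nth p0 h i).1 j) (size h) s4.
  by exists (dn, z).
exists s, (fun n => (u n).1), (fun n => (u n).2); split=> // n.
have := hu n; cbv zeta; rewrite size_mkseq.
set d1 := (fun i j => (nth p0 (mkseq u n) i).1 j).
have dE i j : (i < n)%N -> d1 i j = (u i).1 j by move=> hi; rewrite /d1 nth_mkseq.
have UE m j : (m <= n)%N -> U d1 m j = U (fun n => (u n).1) m j.
  move=> mn; apply: eq_bigr => i _; apply: dE; exact: leq_trans (ltn_ord i) mn.
(* [xi] reads only the steps below [prv n <= n], so the history of length [n] determines it. *)
have -> : xi d1 n = xi (fun n => (u n).1) n.
  by rewrite /xi; congr (_ - _); apply: eq_bigr => j _; rewrite !UE.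
case=> h1 h2; split=> // /h2 [g1 g2 g3 g4 g5]; split=> // j jn.
have [g21 g22] := g2 j jn; split=> // i i' hi hi'.
by rewrite -dE //; exact: g21.
Qed.

(** * Invariants of the construction and the limit vectors *)

Section Limit.
Variables (s : nat -> R) (d : nat -> nat -> H) (z : nat -> H).
Hypothesis s_le : forall j, s j <= 1 / 4.
Hypothesis sum_le_s : forall j m, \sum_(n < m) tau j n <= s j.
Hypothesis s_lim : forall j e, 0 < e ->
  exists N, forall m, (N <= m)%N -> s j - \sum_(n < m) tau j n <= e.
Hypothesis zE : forall n, z n = c0%:C%C *: xi d n.
Hypothesis z_good : forall n, nsq (z n) <= c0 ^+ 2 -> good s d n (d n) (z n).

Let eps j m : R := s j - \sum_(n < m) tau j n.
Let e n j : H := new (d n) n (z n) j.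
Let V m j : H := U d m j.

Let eps_ge0 j m : 0 <= eps j m. Proof. by rewrite subr_ge0. Qed.
Let eps_le j m : eps j m <= 1 / 4.
Proof.
apply: le_trans (s_le j); rewrite gerDl oppr_le0.
by apply: sumr_ge0 => n _; exact: tau_ge0.
Qed.

(** The partial vectors are exactly orthogonal and fall short of norm 1 only by the unspent reserve
    [eps]; linked values are exact as soon as both indices are below [m], and never change
    afterwards. *)
Let Gram m : Prop := forall i j, (i < m)%N -> (j < m)%N ->
  ip (V m j) (V m i) = (i == j)%:R * (1 - eps i m)%:C%C /\
  (link i j -> forall l, (l < k)%N -> ip (iter l.+1 T (V m j)) (V m i) = aa i j l).

Let z0 n : Y n = 0 -> z n = 0.
Proof.
move=> Yn; rewrite zE /xi Yn big1 ?subr0 ?scaler0 // => j _.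
by rewrite ip0l mul0r scale0r.
Qed.

Let e_V n m i j : good s d n (d n) (z n) -> (m <= n)%N -> (i < n)%N -> (j <= n)%N ->
  tort T k (e n j) (V m i).
Proof.
move=> [_ h _ _ _] mn hi hj; apply: (tort_sum bT) => i' _.
have [h1 _] := h j hj; apply: h1 => //; exact: leq_trans (ltn_ord i') mn.
Qed.

Let e_xi n m j : good s d n (d n) (z n) -> (prv m <= n)%N -> (j <= n)%N ->
  tort T k (e n j) (xi d m).
Proof.
move=> gn pn hj; apply: (tortD bT).
  have [t tp ->] := Y_target m; have [_ h _ _ _] := gn.
  by have [_ h2] := h j hj; apply: h2; exact: leq_trans tp pn.
rewrite -scaleN1r; apply: (tortZ bT); apply: (tort_sum bT) => i _.
apply: (tortZ bT); apply: e_V => //; exact: leq_trans (ltn_ord i) pn.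
Qed.

Let e_z n m j : good s d n (d n) (z n) -> (prv m <= n)%N -> (j <= n)%N ->
  tort T k (e n j) (z m).
Proof. by move=> *; rewrite zE; apply: (tortZ bT); exact: e_xi. Qed.

Let nsqV m j : Gram m -> (j < m)%N -> nsq (V m j) = 1 - eps j m.
Proof. by move=> Gm jm; have [h _] := Gm j j jm jm; rewrite /nsq h eqxx mul1r. Qed.

Let nsqV_gt0 m j : Gram m -> (j < m)%N -> 0 < nsq (V m j).
Proof. by move=> Gm jm; rewrite nsqV //; have := eps_le j m; lra. Qed.

Let xi_V n i : Gram (prv n) -> (i < prv n)%N -> ip (xi d n) (V (prv n) i) = 0.
Proof.
move=> Gn hi; rewrite ipBl ip_suml (bigD1 (Ordinal hi)) //= ipZl ipxx.
rewrite divfK; last by rewrite eq_complex /= eqxx andbT gt_eqF // nsqV_gt0.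
rewrite big1 ?addr0 ?subrr // => j; rewrite -val_eqE /= => ji.
have [h _] := Gn i j hi (ltn_ord j).
by rewrite ipZl h eq_sym (negbTE ji) mul0r mulr0.
Qed.

Let xi_pyth n : Gram (prv n) ->
  nsq (Y n) = nsq (xi d n) + nsq (Y n - xi d n) /\ ip (xi d n) (Y n) = (nsq (xi d n))%:C%C.
Proof.
move=> Gn; have h : ip (xi d n) (Y n - xi d n) = 0.
  rewrite {2}/xi opprB addrC subrK ip_sumr big1 // => j _.
  by rewrite ipZr xi_V ?mulr0.
split; first by rewrite -nsq_pyth // addrC subrK.
by rewrite -{1}(subrK (xi d n) (Y n)) ipDr h add0r ipxx.
Qed.

Let good_of_Gram n : Gram (prv n) -> good s d n (d n) (z n).
Proof.
move=> Gn; apply: z_good; rewrite zE nsqZ normcR ger0_norm ?(ltW c0_gt0) //.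
rewrite ler_piMr ?sqr_ge0 //; have [h _] := xi_pyth Gn.
have [t _ Yt] := Y_target n; have := y_le1 t; rewrite -Yt h.
by have := nsq_ge0 (Y n - xi d n); lra.
Qed.

Let d_old n j : j != n -> d n j = e n j.
Proof. by move=> /negbTE jn; rewrite /e /new jn. Qed.

Let d_diag n : d n n = z n + e n n.
Proof. by rewrite /e /new eqxx addrC subrK. Qed.

Let V_S m j : V m.+1 j = V m j + d m j.
Proof. by rewrite /V /U big_ord_recr. Qed.

Let V_start n : (forall i, (i < n)%N -> good s d i (d i) (z i)) -> V n n = 0.
Proof.
by move=> g; rewrite /V /U big1 // => i _; have [h _ _ _ _] := g i (ltn_ord i); exact: h.
Qed.

Let V_before m n j : (j < n)%N -> (n <= m)%N ->
  V m j = V n j + \sum_(n <= i < m) e i j.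
Proof.
move=> jn nm; rewrite /V /U -!(big_mkord xpredT (fun i => d i j)).
rewrite (@big_cat_nat _ _ _ n) //=; congr (_ + _).
apply: eq_big_nat => i /andP[ni _]; apply: d_old.
by rewrite ltn_eqF // (leq_trans jn).
Qed.

Let V_from m j : (forall i, (i < m)%N -> good s d i (d i) (z i)) -> (j < m)%N ->
  V m j = z j + \sum_(j <= i < m) e i j.
Proof.
move=> g jm; rewrite (@V_before m j.+1) // V_S V_start; last first.
  by move=> i ij; exact/g/ltnW/(leq_ltn_trans ij).
by rewrite add0r d_diag (big_ltn jm) addrA.
Qed.

(* The part of [u_m] chosen in advance does not disturb the relations already
   achieved. *)
Let z_V m j : (forall i, (i < m)%N -> good s d i (d i) (z i)) -> Gram (prv m) ->
  (j < m)%N -> ip (V m j) (z m) = 0 /\ (~ (j < prv m)%N -> tort T k (V m j) (z m)).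
Proof.
(* Below [prv m], the state of [u_j] at step [prv m] is only orthogonal to [z m], by the projection,
   while later pieces are [T]-orthogonal to it. From [prv m] on, spacing leaves either no target
   part in [u_j] or [z m = 0], and all other pieces are [T]-orthogonal to [z m]. *)
move=> g Gm jm; have [jp|pj] := ltnP j (prv m).
  split=> //; rewrite (@V_before m (prv m)) // ipDl.
  rewrite zE ipZr (ip_eq0C (xi_V Gm jp)) mulr0 add0r -zE.
  rewrite big_nat ip_suml big1 // => i /andP[pi im].
  by have [] := e_z (g i im) pi (leq_trans (ltnW jp) pi) (isT : (0 <= k)%N).
suff h : tort T k (V m j) (z m) by split=> //; have [] := h 0%N isT.
rewrite V_from //; apply: tortC; apply: (tortD bT).
  have [Y0|Y0] := Y_apart jm pj; last by rewrite (z0 Y0); apply: tortC; exact: tort0.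
  by rewrite (z0 Y0); exact: tort0.
rewrite big_nat; apply: (tort_sum bT) => i /andP[ji im]; apply: tortC.
by apply: e_z => //; [exact: g|exact: leq_trans pj ji].
Qed.

Let ip_tort_add l (x1 x2 x3 x4 : H) : (l <= k)%N ->
  tort T k x3 x2 -> tort T k x4 x1 ->
  ip (iter l T (x1 + x3)) (x2 + x4) = ip (iter l T x1) x2 + ip (iter l T x3) x4.
Proof.
move=> lk /(_ l lk)[h1 _] /(_ l lk)[_ h2].
by rewrite (linD (lin_iter l)) ipDl !ipDr h1 h2 addr0 add0r.
Qed.

(** Step [m] is good only once [z m] is known to be short, which needs [Gram (prv m)] so that [xi]
    is a true projection; hence the strong induction. *)
Let Gram_all m : Gram m /\ forall n, (n < m)%N -> good s d n (d n) (z n).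
Proof.
elim/ltn_ind: m => [[|m]] IH; first by split.
have [Gm gm] := IH m (leqnn _).
have Gp : Gram (prv m) by have [] := IH (prv m) (prv_le m).
have g := good_of_Gram Gp.
have gall n : (n < m.+1)%N -> good s d n (d n) (z n).
  by rewrite ltnS leq_eqVlt => /orP[/eqP ->//|]; exact: gm.
split=> //.
have [_ _ [gn gw] gee gej] := g.
pose O j := if j == m then z m else V m j.
have VO j : (j < m.+1)%N -> V m.+1 j = O j + e m j.
  rewrite V_S /O; case: eqVneq => [->|jm] _; last by rewrite d_old.
  by rewrite V_start // add0r d_diag.
have eO i j : (i < m.+1)%N -> (j < m.+1)%N -> tort T k (e m j) (O i).
  rewrite /O; case: eqVneq => [_ _ hj|im hi hj]; first exact: e_z.
  by apply: e_V => //; rewrite ltn_neqAle im.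
have split_ip i j l : (l <= k)%N -> (i < m.+1)%N -> (j < m.+1)%N ->
    ip (iter l T (V m.+1 j)) (V m.+1 i) =
    ip (iter l T (O j)) (O i) + ip (iter l T (e m j)) (e m i).
  by move=> lk hi hj; rewrite !VO // ip_tort_add //; exact: eO.
have epsS i : eps i m.+1 = eps i m - tau i m.
  by rewrite /eps big_ord_recr /= opprD addrA.
move=> i j hi hj; split.
  rewrite (split_ip _ _ 0%N) //= /O.
  case: (eqVneq j m) hj => [-> _|jm hj]; case: (eqVneq i m) hi => [-> _|im hi].
  - rewrite [true%:R](_ : _ = 1) // mul1r !ipxx -(rmorphD (real_complex R)); congr (_ %:C)%C.
    have tmm : tau m m = 0 by rewrite /tau eqxx.
    rewrite /= gn /eps big_ord_recr /= tmm addr0.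
    (* Symmetry of [tau]: what [u_m] receives from its links with older vectors is what its own
       reserve [s m] held for them. *)
    have -> : \sum_(j < m) tau j m = \sum_(j < m) tau m j.
      by apply: eq_bigr => ? _; exact: tauC.
    by ring.
  - have im' : (i < m)%N by rewrite ltn_neqAle im.
    have [/ip_eq0C -> _] := z_V gm Gp im'.
    have [_ /ip_eq0C -> _] := gej i im'.
    by rewrite [false%:R](_ : _ = 0) // mul0r addr0.
  - have jm' : (j < m)%N by rewrite ltn_neqAle jm.
    have [-> _] := z_V gm Gp jm'.
    have [_ -> _] := gej j jm'.
    by rewrite eq_sym (negbTE jm) mul0r addr0.
  - have jm' : (j < m)%N by rewrite ltn_neqAle jm.
    have im' : (i < m)%N by rewrite ltn_neqAle im.
    have [-> _] := Gm i j im' jm'; rewrite epsS.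
    case: (eqVneq i j) => [->|ij].
      have [h _ _] := gej j jm'.
      rewrite !mul1r ipxx h -(rmorphD (real_complex R)); congr (_ %:C)%C => /=; ring.
    have [_ h] := gee i j im' jm' ij 0%N isT.
    by rewrite !mul0r add0r.
move=> lij l lk; rewrite split_ip // /O.
case: (eqVneq j m) lij hj => [-> lij _|jm lij hj];
  case: (eqVneq i m) lij hi => [-> lij _|im lij hi].
- by rewrite gw // addrC subrK.
- have im' : (i < m)%N by rewrite ltn_neqAle im.
  have [_ hz] := z_V gm Gp im'.
  have [|_ h0] := hz _ l.+1 lk; first by move=> /prv_free[h1 h2]; exact: h1.
  have [_ _ /(_ l lk)[_ -> _]] := gej i im'.
  by rewrite h0 add0r.
- have jm' : (j < m)%N by rewrite ltn_neqAle jm.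
  have [_ hz] := z_V gm Gp jm'.
  have [|h0 _] := hz _ l.+1 lk; first by move=> /prv_free[h1 h2]; exact: h2.
  have [_ _ /(_ l lk)[-> _ _]] := gej j jm'.
  by rewrite h0 add0r.
- have jm' : (j < m)%N by rewrite ltn_neqAle jm.
  have im' : (i < m)%N by rewrite ltn_neqAle im.
  have [_ /(_ lij l lk) ->] := Gm i j im' jm'.
  have -> : ip (iter l.+1 T (e m j)) (e m i) = 0; last by rewrite addr0.
  case: (eqVneq i j) => [->|ij]; first by have [_ _ /(_ l lk)[]] := gej j jm'.
  by have [_] := gee i j im' jm' ij l.+1 lk.
Qed.

Let G m : Gram m. Proof. by have [] := Gram_all m. Qed.
Let gd n : good s d n (d n) (z n). Proof. by have [_] := Gram_all n.+1; apply. Qed.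

Let nsq_incr m p j : (j < m)%N -> nsq (V (m + p) j - V m j) = eps j m - eps j (m + p).
Proof.
move=> jm; elim: p => [|p IH]; first by rewrite addn0 !subrr nsq0.
have jmp : (j < m + p)%N by apply: leq_trans jm _; exact: leq_addr.
rewrite addnS V_S d_old ?ltn_eqF // addrAC nsq_pyth.
  rewrite IH /eps big_ord_recr /=; have [_ _ _ _ /(_ j jmp)[-> _ _]] := gd (m + p).
  by ring.
have [_ h1] := e_V (gd (m + p)) (leqnn _) jmp (ltnW jmp) (isT : (0 <= k)%N).
have [_ h2] := e_V (gd (m + p)) (leq_addr p m) jmp (ltnW jmp) (isT : (0 <= k)%N).
by rewrite ipBl /= in h1 h2 *; rewrite h1 h2 subrr.
Qed.

Lemma limit_exists : exists u : nat -> H, forall j, tends (V ^~ j) (u j).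
Proof.
suff /choice[u hu] : forall j, exists x, tends (V ^~ j) x by exists u.
move=> j; apply: ip_complete => r r0.
have [N hN] := s_lim j r0; exists (maxn N j.+1).
suff h m n : (maxn N j.+1 <= m)%N -> (m <= n)%N -> nsq (V n j - V m j) <= r.
  move=> m n hm hn; have [mn|/ltnW nm] := leqP m n; last exact: h.
  by rewrite nsqBC; exact: h.
rewrite geq_max => /andP[Nm jm] mn; rewrite -(subnKC mn) nsq_incr //.
by have := hN m Nm; have := eps_ge0 j (m + (n - m)); rewrite -/(eps j m); lra.
Qed.

(** * Orthonormality, linked values and completeness of the limit *)

Section Completeness.
Variable u : nat -> H.
Hypothesis Vu : forall j, tends (V ^~ j) (u j).

Lemma limit_gram i j : ip (u i) (u j) = (i == j)%:R.
Proof.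
pose m0 := (maxn i j).+1.
have hm n : (i < n + m0)%N /\ (j < n + m0)%N.
  by rewrite /m0 addnS !ltnS; split; apply: leq_trans (leq_addl _ _);
    rewrite ?leq_maxl ?leq_maxr.
apply: (ip_lim (tends_shift m0 (Vu i)) (tends_shift m0 (Vu j))) => r r0.
have [N hN] := s_lim j r0; exists N => n Nn.
have [hi hj] := hm n; have [-> _] := G hj hi.
rewrite eq_sym; case: eqP => _; last by rewrite mul0r subrr Normc.normc0 ltW.
rewrite mul1r -(rmorph1 (real_complex R)) -rmorphB normcR addrAC subrr add0r normrN.
by rewrite ger0_norm //; apply: hN; exact: leq_trans Nn (leq_addr _ _).
Qed.

Lemma limit_link i j l : link i j -> (l < k)%N -> ip (iter l.+1 T (u j)) (u i) = aa i j l.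
Proof.
move=> lij lk; pose m0 := (maxn i j).+1.
have hm n : (i < n + m0)%N /\ (j < n + m0)%N.
  by rewrite /m0 addnS !ltnS; split; apply: leq_trans (leq_addl _ _);
    rewrite ?leq_maxl ?leq_maxr.
apply: (ip_lim (tends_bop (bop_iter l.+1 bT) (tends_shift m0 (Vu j))) (tends_shift m0 (Vu i))).
move=> r r0; exists 0%N => n _; have [hi hj] := hm n.
have [_ /(_ lij l lk) h] := G hi hj.
by rewrite [_ \o _]/= h subrr Normc.normc0 ltW.
Qed.

Let tail_orth m j x : (j < m)%N -> (forall n, (m <= n)%N -> ip (e n j) x = 0) ->
  ip (u j - V m j) x = 0.
Proof.
move=> jm hx; have h : tends (fun n => V (n + m) j - V m j) (u j - V m j).
  by apply: tendsD; [exact: (tends_shift m (Vu j))|exact: tends_cst].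
apply: (ip_lim0 h) => n.
rewrite (@V_before (n + m) m) ?leq_addl // addrAC subrr add0r big_nat ip_suml big1 //.
by move=> i /andP[mi _]; exact: hx.
Qed.

Let tail_target m j t : (j < m)%N -> (t <= m)%N -> ip (u j - V m j) (y t) = 0.
Proof.
move=> jm tm; apply: tail_orth => // n mn; have [_ h _ _ _] := gd n.
have [_ h2] := h j (leq_trans (ltnW jm) mn).
by have [] := h2 t (leq_trans tm mn) 0%N isT.
Qed.

Let tail_V m i j : (j < m)%N -> (i < m)%N -> ip (u j - V m j) (V m i) = 0.
Proof.
move=> jm im; apply: tail_orth => // n mn.
by have [] := e_V (gd n) mn (leq_trans im mn) (leq_trans (ltnW jm) mn) (isT : (0 <= k)%N).
Qed.

(** All pieces of [u_n] other than [z n] are orthogonal to [y t], and [z n] is [c0] times the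
    component [xi] of [y t]. *)
Let ip_target n t : Y n = y t -> (t <= prv n)%N -> ip (u n) (y t) = (c0 * nsq (xi d n))%:C%C.
Proof.
move=> Yt tp; have tn := leq_trans tp (prv_le n).
have := @tail_target n.+1 n t (leqnn _) (leqW tn).
rewrite V_S V_start // add0r d_diag ipBl ipDl => /eqP; rewrite subr_eq0 => /eqP ->.
have [_ h _ _ _] := gd n; have [_ h2] := h n (leqnn n).
have [/= -> _] := h2 t tn 0%N isT; rewrite addr0 zE ipZl -Yt.
have [_ ->] := xi_pyth (G (m := prv n)).
by rewrite -(rmorphM (real_complex R)).
Qed.

(** Otherwise [y t] would have coefficients at least [c0 * r] on infinitely many of the orthonormal
    [u_n], with [n] taken along the increasing sequence [f]. *)
Let small_xi t (r : R) : 0 < r ->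
  exists n, [/\ (t <= prv n)%N, Y n = y t & nsq (xi d n) <= r].
Proof.
move=> r0; apply: contrapT => nox.
have /choice[nx hnx] : forall m, exists n, (maxn t m <= prv n)%N /\ Y n = y t.
  by move=> m; exact: y_often.
have {}hnx m : [/\ (t <= prv (nx m))%N, (m <= prv (nx m))%N & Y (nx m) = y t].
  by have [h hY] := hnx m; split; rewrite // (leq_trans _ h) // leq_max leqnn ?orbT.
pose f := fix f i := if i is i'.+1 then nx (f i').+1 else nx 0%N.
have fP i : (t <= prv (f i))%N /\ Y (f i) = y t.
  by case: i => [|i] /=; [have [] := hnx 0%N|have [] := hnx (f i).+1].
have fS i : (f i < f i.+1)%N.
  by have [_ h _] := hnx (f i).+1; exact: leq_trans h (prv_le _).
have fI i j : (i < j)%N -> (f i < f j)%N.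
  by move=> ij; apply: (homo_ltn ltn_trans fS).
have fon n : orthofamily n (fun i => u (f i)).
  move=> i j _ _; rewrite limit_gram; congr (_%:R); congr nat_of_bool.
  by case: (ltngtP i j) => [/fI h|/fI h|->]; rewrite ?eqxx // ?(ltn_eqF h) ?(gtn_eqF h).
pose b := (c0 * r) ^+ 2; have b0 : 0 < b by rewrite exprn_gt0 // mulr_gt0.
have big n : n%:R * b <= 1.
  apply: le_trans (y_le1 t); apply: le_trans (bessel (y t) (fon n)).
  rewrite -[n in n%:R]card_ord -sum1_card natr_sum mulr_suml; apply: ler_sum => i _.
  have [h1 h2] := fP i; rewrite mul1r ipC normc_conjc ip_target // normcR.
  have h3 : r < nsq (xi d (f i)).
    by rewrite ltNge; apply/negP => h; apply: nox; exists (f i).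
  have h4 : c0 * r <= c0 * nsq (xi d (f i)) by rewrite ler_wpM2l // ltW.
  have h5 : 0 <= c0 * r by rewrite mulr_ge0 // ltW.
  by rewrite /b lerXn2r ?nnegrE // (le_trans h4) // ler_norm.
have := big (Num.truncn b^-1).+1; have := truncnS_gt b^-1.
set N := _%:R; rewrite -(ltr_pM2r b0) mulVf ?gt_eqF //; lra.
Qed.

(** The projection [P] of [y t] combines partial vectors, to which [x] need not be orthogonal.
    Adding the tails [W] puts [P + W] in the span of the [u j], so [<P, x> = - <W, x>]; as [W] is
    orthogonal to [y t], this is [- <W, x - y t>], which is small. Hence
    [|<y t, x>| <= 1/32 + 1/16], while closeness of [y t] to [x] forces at least [1/4 - 1/32]. *)
Lemma limit_complete x0 : (forall j, ip x0 (u j) = 0) -> x0 = 0.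
Proof.
move=> hx0; apply/eqP/negPn/negP => x0nz.
have hnx : 0 < hn x0 by rewrite lt_def hn_ge0 hn_eq0 x0nz.
have [x [x4 hx]] : exists x, nsq x = 1 / 4 /\ forall j, ip x (u j) = 0.
  exists (((2 * hn x0)^-1)%:C%C *: x0); split.
    rewrite nsqZ normcR ger0_norm ?invr_ge0 ?mulr_ge0 ?hn_ge0 // -hn2.
    by field; rewrite gt_eqF.
  by move=> j; rewrite ipZl hx0 mulr0.
have p16 : 0 < (1 / 16 : R) ^+ 2 by rewrite exprn_gt0 // divr_gt0.
have [t ht] := y_dense p16 x4.
have [n [tp Yt nxi]] := @small_xi t _ p16.
pose m := prv n.
pose b j := ip (Y n) (V m j) / (nsq (V m j))%:C%C.
pose P := \sum_(j < m) b j *: V m j.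
have YE : y t = xi d n + P by rewrite -Yt /xi subrK.
pose W := \sum_(j < m) b j *: (u j - V m j).
have WP : ip P W = 0.
  apply: ip_eq0C; rewrite ip_suml big1 // => j _.
  rewrite ipZl ip_sumr big1 ?mulr0 // => i _.
  by rewrite ipZr tail_V ?mulr0.
have ou : orthofamily m u by move=> i j _ _; exact: limit_gram.
have nPW : nsq P + nsq W = \sum_(j < m) normc (b j) ^+ 2.
  rewrite -nsq_pyth // -(nsq_orthonormal_sum b ou) -big_split /=; congr nsq.
  by apply: eq_bigr => j _; rewrite -scalerDr addrC subrK.
have nP : nsq P = \sum_(j < m) normc (b j) ^+ 2 * (1 - eps j m).
  rewrite /nsq ip_sumr Re_sum; apply: eq_bigr => i _.
  rewrite ipZr ip_suml (bigD1 i) //= big1 ?addr0 => [|j ji].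
    by rewrite ipZl ipxx nsqV // mulrA [_ * b i]mulrC mulcJ -rmorphM.
  have [h _] := G (ltn_ord i) (ltn_ord j).
  by rewrite ipZl h -val_eqE eq_sym in ji *; rewrite (negbTE ji) mul0r mulr0.
(* [W] and [P] weigh the same squared coefficients by [eps] and [1 - eps], and [eps <= 1/4]. *)
have nWP : nsq W <= nsq P.
  have -> : nsq W = \sum_(j < m) normc (b j) ^+ 2 * eps j m.
    have -> : nsq W = \sum_(j < m) normc (b j) ^+ 2 - nsq P by rewrite -nPW; ring.
    rewrite nP -sumrB; apply: eq_bigr => j _; ring.
  rewrite nP; apply: ler_sum => j _; rewrite ler_wpM2l ?sqr_ge0 //.
  by have := eps_le j m; lra.
have [py _] := xi_pyth (G (m := prv n)).
have nP1 : nsq P <= 1.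
  have e1 : Y n - xi d n = P by rewrite Yt YE addrC addKr.
  have := y_le1 t; rewrite -Yt py e1; have := nsq_ge0 (xi d n); lra.
have ipyx : ip (y t) x = ip (xi d n) x - ip W (x - y t).
  rewrite YE ipDl; congr (_ + _).
  rewrite ip_suml ip_suml -sumrN; apply: eq_bigr => j _.
  rewrite !ipZl -mulrN; congr (_ * _).
  have h1 : ip (u j - V m j) (y t) = 0 by apply: tail_target.
  by rewrite ipBr -YE h1 subr0 ipBl (ip_eq0C (hx j)) sub0r opprK.
have hx2 : hn x = 1 / 2.
  by apply/eqP; rewrite -(@eqrXn2 _ 2) ?hn_ge0 ?divr_ge0 // hn2 x4; apply/eqP; field.
have q16 : 0 <= 1 / 16 :> R by exact: divr_ge0.
have hxi : hn (xi d n) <= 1 / 16 by rewrite hn_le.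
have hyx : hn (y t - x) <= 1 / 16 by rewrite hn_le.
have hxy : hn (x - y t) <= 1 / 16 by rewrite -hnN opprB.
have hW : hn W <= 1 by rewrite hn_le // expr1n (le_trans nWP).
have b1 : normc (ip (y t) x) <= 3 / 32.
  rewrite ipyx; apply: le_trans (normcB _ _) _.
  have h1 := cauchy_schwarz (xi d n) x; have h2 := cauchy_schwarz W (x - y t).
  have h3 : hn W * hn (x - y t) <= 1 * (1 / 16) by apply: ler_pM; rewrite ?hn_ge0.
  rewrite hx2 in h1; lra.
have b2 : Re (ip (y t) x) = 1 / 4 + Re (ip (y t - x) x).
  by rewrite ipBl ReB -/(nsq x) x4; ring.
have b3 := Re_le_normc (ip (y t) x).
have b4 := Re_ge_normc (ip (y t - x) x).
have b5 := cauchy_schwarz (y t - x) x; rewrite hx2 in b5.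
by move: (normc _) (normc _) b1 b3 b4 b5 => n1 n2 b1 b3 b4 b5; lra.
Qed.

End Completeness.
End Limit.

Lemma basis_exists : exists u : nat -> H, [/\
  forall i j, ip (u i) (u j) = (i == j)%:R,
  forall i j l, link i j -> (l < k)%N -> ip (iter l.+1 T (u j)) (u i) = aa i j l &
  forall x, (forall j, ip x (u j) = 0) -> x = 0].
Proof.
have [s [d [z [s1 s2 s3 hz]]]] := construction.
have zE n : z n = c0%:C%C *: xi d n by have [] := hz n.
have zg n : nsq (z n) <= c0 ^+ 2 -> good s d n (d n) (z n) by have [_] := hz n.
have [u hu] := limit_exists s1 s2 s3 zE zg.
exists u; split.
- exact: (limit_gram s1 s2 s3 zE zg hu).
- exact: (limit_link s1 zE zg hu).
- exact: (limit_complete s1 s2 s3 zE zg hu).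
Qed.

End BasisConstruction.

(** * Transfer to the given space *)

Lemma esum_partial_sum (R : realType) (S : set nat) (f : nat -> R) (b : R) m :
  (forall i, 0 <= f i) -> (\esum_(i in S) (f i)%:E <= b%:E)%E ->
  \sum_(i < m) (if (i : nat) \in S then f i else 0) <= b.
Proof.
move=> f0; rewrite esum_mkcond -nneseries_esumT; last first.
  by move=> i; case: ifP => // _; rewrite lee_fin.
rewrite -lee_fin; apply: le_trans.
rewrite -sumEFin -(big_mkord xpredT (fun i : nat => (if i \in S then f i else 0)%:E)).
under eq_bigr => i _ do rewrite (fun_if EFin).
by apply: nneseries_lim_ge => i _; case: ifP => // _; rewrite lee_fin.
Qed.

Lemma cmod_le_supnorm (R : realType) k (v : 'rV[R[i]]_k) (l : 'I_k) :
  normc (v ord0 l) <= supnorm v.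
Proof. by rewrite /supnorm (bigD1 l) //= le_max lexx. Qed.

Lemma supnorm_ge0 (R : realType) k (v : 'rV[R[i]]_k) : 0 <= supnorm v.
Proof. by rewrite /supnorm; elim/big_rec: _ => // l x _ x0; rewrite le_max x0 orbT. Qed.

Section Transfer.
Variables (R : realType) (H : completeNormedModType R[i]) (dp : {dot H for Num.conj}).
Hypothesis dp_norm : induces_norm dp.
Implicit Types x y : H.

Lemma dotC x y : dp x y = ((dp y x)^*)%C.
Proof. by rewrite hermC expr0 mul1r. Qed.

Lemma dot_norm x : `|x| = (Num.sqrt (Re (dp x x)))%:C%C.
Proof.
have h := dp_norm x; have n0 : 0 <= `|x| by exact: normr_ge0.
move: h; rewrite lecE /= in n0; case/andP: n0 => /eqP im0 re0.
have -> : `|x| = (Re `|x|)%:C%C.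
  by apply/complexP.
move=> <-; rewrite -(rmorphXn (real_complex R)) /=.
by rewrite sqrtr_sqr ger0_norm.
Qed.

Lemma dot_complete (u : nat -> H) :
  (forall e : R, 0 < e -> exists N : nat, forall m n : nat,
     (N <= m)%N -> (N <= n)%N -> Re (dp (u m - u n) (u m - u n)) <= e) ->
  exists x, forall e : R, 0 < e -> exists N : nat, forall n : nat,
     (N <= n)%N -> Re (dp (u n - x) (u n - x)) <= e.
Proof.
move=> hu.
have cu : cauchy (u @ \oo).
  apply/cauchy_exP => e; rewrite ltcE /= => /andP[/eqP ie re].
  have [N hN] := hu ((Re e / 2) ^+ 2) (ltac:(by rewrite exprn_gt0 // divr_gt0)).
  exists (u N); exists N => // n /= Nn; rewrite -ball_normE /= dot_norm ltcE /= ie eqxx /=.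
  apply: (@le_lt_trans _ _ (Re e / 2)); last by rewrite ltr_pdivrMr // mulr_natr mulr2n ltrDl.
  have e2 : 0 <= Re e / 2 by rewrite divr_ge0 // ltW.
  rewrite -[leRHS](ger0_norm e2) -sqrtr_sqr; apply: ler_wsqrtr.
  exact: hN.
have /cauchy_cvgP/cvg_ex[x ux] := cu.
exists x => e e0.
have [] := (cvgrPdist_lt _ _).1 ux (Num.sqrt e)%:C%C (ltac:(by rewrite ltcR sqrtr_gt0)).
move=> N _ hN; exists N => n Nn.
have := hN n Nn; rewrite /= distrC dot_norm ltcR => h.
by move: h; rewrite ltr_sqrt // => /ltW.
Qed.

Lemma dot_gt0 x : 0 <= Re (dp x x).
Proof. by have := dnorm_ge0 dp x; rewrite lecE => /andP[]. Qed.

Lemma dot_eq0 x : Re (dp x x) = 0 -> x = 0.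
Proof.
move=> h; apply/eqP; rewrite -(dnorm_eq0 dp).
have := dotC x x; case: (dp x x) h => a b /= -> [hb].
by rewrite eq_complex /= eqxx /=; apply/eqP; lra.
Qed.

Definition hilbert_of_dot : hilbert R :=
  @Hilbert R H (fun x y => dp x y) (fun x y z => linearDl dp z x y)
    (fun a x y => linearZl_LR dp y a x) dotC dot_gt0 dot_eq0 dot_complete.

Let HH := hilbert_of_dot.

Lemma dot_hn (x : HH) : `|(x : H)| = (hn x)%:C%C.
Proof. exact: dot_norm. Qed.

Lemma bop_bounded (T : {linear H -> H}) : bounded_operator T -> @bop R HH T.
Proof.
move=> [M hM]; split; first by move=> a x y; rewrite linearP.
exists (`|Re M| + 1); first by rewrite ltr_wpDl.
move=> x; have := hM x; rewrite !dot_hn lecE => /andP[_].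
rewrite [M * _]mulrC ReZ /= mulrC => h; apply: le_trans h _.
by rewrite ler_wpM2r ?hn_ge0 // (le_trans (ler_norm _)) // lerDl.
Qed.

Lemma not_binv_spectrum (T : {linear H -> H}) (w : R[i]) :
  spectrum T w -> ~ @binv R HH (fun x => T x - w *: x).
Proof.
move=> sw [S [[lS [K K0 hK]] ST TS]]; apply: sw.
pose S' : {linear H -> H} := HB.pack (S : H -> H)
  (GRing.isLinear.Build R[i] H H *:%R S lS).
exists S'; split; last by split.
by exists K%:C%C => x; rewrite !dot_hn -(rmorphM (real_complex R)) lecR.
Qed.

Lemma hull_disc (T : {linear H -> H}) :
  complex_interior (polynomial_hull (spectrum T)) 0 ->
  exists2 r0 : R, 0 < r0 & forall z : R[i], normc z < r0 ->
    forall (q : {poly R[i]}) (b : R),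
    (forall w, ~ @binv R HH (fun x => T x - w *: x) -> normc q.[w] <= b) ->
    normc q.[z] <= b.
Proof.
rewrite /complex_interior => /nbhs_ballP[e /=]; rewrite ltcE /= => /andP[/eqP ie re] he.
exists (Re e) => // z zr q b hb.
have : polynomial_hull (spectrum T) z.
  apply: he; rewrite -ball_normE /= sub0r normrN normc_def ltcE /= ie eqxx /=.
  by case: z zr => x y /=.
move=> /(_ q) h; rewrite -lee_fin; apply: le_trans h _.
apply: ge_ereal_sup => _ [w sw <-]; rewrite lee_fin.
by apply: hb; exact: not_binv_spectrum.
Qed.

(** Index 0 is kept for the zero vector, the idle target, so a dense point [a] sits at [(f a).+1].
    Approximating only the sphere of radius 1/2 leaves room for the approximants in the unit
    ball. *)
Lemma dense_seq : separable H -> exists y : nat -> HH,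
  [/\ y 0%N = 0, forall t, nsq (y t) <= 1 &
  forall (x : HH) (e : R), 0 < e -> nsq x = 1 / 4 -> exists t, nsq (y t - x) <= e].
Proof.
move=> [A [/countable_injP[f finj] dA]].
have /choice[y hy] : forall t : nat, exists y : HH, [/\ t = 0%N -> y = 0, nsq y <= 1 &
    forall a, A a -> t = (f a).+1 -> nsq (a : HH) <= 1 -> y = a].
  case=> [|t]; first by exists 0; split; rewrite ?nsq0.
  have [[a [Aa fa na]]|noa] := pselect (exists a : HH, [/\ A a, f a = t & nsq a <= 1]).
    exists a; split=> // b Ab [tb] _; apply: finj; rewrite ?inE // fa.
    exact: tb.
  by exists 0; split; rewrite ?nsq0 // => a Aa [ta] na; case: noa; exists a.
exists y; split=> [|t|x e e0 x4]; [by have [->] := hy 0%N|by have [] := hy t|].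
pose r := Num.min (Num.sqrt e) (1 / 2).
have r0 : 0 < r by rewrite lt_min sqrtr_gt0 e0 divr_gt0.
have [a [xa Aa]] : exists a : H, `|x - a| < r%:C%C /\ A a.
  have rC : 0 < r%:C%C :> R[i] by rewrite ltcR.
  have ne : ball (x : H) r%:C%C !=set0 by exists x; exact: ballxx.
  have [a [ba Aa]] := dA _ ne (ball_open (x : H) r%:C%C).
  by exists a; split=> //; move: ba; rewrite -ball_normE.
move: xa; rewrite (dot_hn (x - a)) ltcR lt_min => /andP[xa1 xa2].
have hx : hn x = 1 / 2.
  by apply/eqP; rewrite -(@eqrXn2 _ 2) ?hn_ge0 ?divr_ge0 // hn2 x4; apply/eqP; field.
have na : nsq (a : HH) <= 1.
  rewrite -(expr1n _ 2) -hn_le //.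
  have -> : (a : HH) = x - (x - a) by rewrite opprB addrC subrK.
  by apply: le_trans (hnB _ _) _; lra.
exists (f a).+1; have [_ _ h] := hy (f a).+1; rewrite (h a) // nsqBC.
by rewrite -[e]sqr_sqrtr ?(ltW e0) // -hn_le ?sqrtr_ge0 // ltW.
Qed.

(** The limits of finite combinations form a closed subspace [M]; were it proper, [orth_exists]
    would give a nonzero vector orthogonal to all [u j]. *)
Lemma complete_closure (u : nat -> HH) :
  (forall x : HH, (forall j, ip x (u j) = 0) -> x = 0) ->
  closure (lin_span (u : nat -> H)) = setT.
Proof.
move=> cu; apply/seteqP; split=> // x _.
pose M (x : HH) := forall e : R, 0 < e -> exists n (c : nat -> R[i]),
  hn (x - \sum_(i < n) c i *: u i) <= e.
have widen n m (c : nat -> R[i]) : (n <= m)%N ->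
    \sum_(i < n) c i *: u i = \sum_(i < m) (if (i < n)%N then c i else 0) *: u i.
  move=> nm; rewrite (big_ord_widen m (fun i => c i *: u i) nm) big_mkcond /=.
  by apply: eq_bigr => i _; case: ifP => // _; rewrite scale0r.
have Mx : M x.
  apply: contrapT => nMx.
  have [] := @orth_exists R HH M x _ _ _ nMx.
  - by move=> e e0; exists 0%N, (fun=> 0); rewrite big_ord0 subr0 hn0 ltW.
  - move=> a y z hy hz e e0.
    have a1 : 0 < normc a + 1 by rewrite ltr_wpDl // normc_ge0.
    have [n [c hc]] := hy (e / 2 / (normc a + 1)) (ltac:(by rewrite !divr_gt0)).
    have [m [d hd]] := hz (e / 2) (ltac:(by rewrite divr_gt0)).
    exists (maxn n m), (fun i =>
      a * (if (i < n)%N then c i else 0) + (if (i < m)%N then d i else 0)).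
    under eq_bigr => i _ do rewrite scalerDl -scalerA.
    rewrite big_split /= -scaler_sumr -!widen ?leq_maxl ?leq_maxr //.
    rewrite opprD addrACA -scalerBr; apply: le_trans (hnD _ _) _.
    rewrite hnZ; have -> : e = e / 2 + e / 2 by lra.
    apply: lerD => //; apply: (@le_trans _ _ ((normc a + 1) * (e / 2 / (normc a + 1)))).
      by apply: ler_pM; rewrite ?normc_ge0 ?hn_ge0 ?lerDl.
    by rewrite mulrC divfK // gt_eqF.
  - move=> v y Mv /tendsP vy e e0; have e2 : 0 < e / 2 by rewrite divr_gt0.
    have [N hN] := vy _ e2; have [n [c hc]] := Mv N _ e2.
    exists n, c; set w := \sum_(i < n) _.
    have -> : y - w = (v N - w) - (v N - y) by rewrite opprB [RHS]addrC addrA subrK.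
    by apply: le_trans (hnB _ _) _; have := hN N (leqnn _); rewrite -/w in hc; lra.
  - move=> y ynz My; move: ynz; rewrite (cu y) ?eqxx // => j.
    apply: ip_eq0C; apply: My => e e0; exists j.+1, (fun i => (i == j)%:R).
    rewrite big_ord_recr /= eqxx scale1r big1 ?add0r ?subrr ?hn0 ?(ltW e0) // => i _.
    by rewrite (ltn_eqF (ltn_ord i)) scale0r.
move=> B /nbhs_ballP[e /=]; rewrite ltcE /= => /andP[/eqP ie re] eB.
have [n [c hc]] := Mx (Re e / 2) (ltac:(by rewrite divr_gt0)).
exists (\sum_(i < n) c i *: u i); split.
  exists (iota 0 n), c.
  by rewrite -(big_mkord xpredT (fun i => c i *: u i)) /index_iota subn0.
apply: eB; rewrite -ball_normE /= (dot_hn (x - _)) ltcE /= ie eqxx /=.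
by apply: le_lt_trans hc _; lra.
Qed.

End Transfer.

(** Iterating admissibility gives [N 0 < N 1 < ...] with [N i.+1] unlinked to all indices up to
    [N i]. Only the [N i.+1] get a target, with exclusive bound [prv = (N i).+1]; all other steps
    get the idle target 0. No other [N] lies strictly between two consecutive ones, hence the
    spacing. *)
Lemma schedule (B : set (nat * nat)) : admissible B ->
  exists prv tg : nat -> nat,
  [/\ forall n, (prv n <= n)%N,
   forall n j, (j < prv n)%N ->
     ~ (B `|` diagonal) (j, n) /\ ~ (B `|` diagonal) (n, j),
   forall n m, (n < m)%N -> (prv m <= n)%N -> tg n = 0%N \/ tg m = 0%N,
   forall n, (tg n <= prv n)%N &
   forall t m, exists n, (m <= prv n)%N /\ tg n = t].
Proof.
move=> [_ adm].
have /choice[next hnext] := adm.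
pose N := fix N i := if i is i'.+1 then next (N i') else 0%N.
have NS i : (N i < N i.+1)%N by have [] := hnext (N i).
have Nlt i j : (i < j)%N -> (N i < N j)%N by move=> ij; exact: (homo_ltn ltn_trans NS).
have Nge i : (i <= N i)%N.
  by elim: i => // i IH; exact: leq_ltn_trans IH (NS i).
have Ninj i j : N i = N j -> i = j.
  by case: (ltngtP i j) => // /Nlt; [move=> + h|move=> + h]; rewrite h ltnn.
pose g i := logn 2 i.+1.
have gle i : (g i <= i)%N by rewrite /g -ltnS ltn_logl.
have gt t m : exists i, (m <= i)%N /\ g i = t.
  exists (2 ^ t * (2 * m).+1).-1.
  have p0 : (0 < 2 ^ t * (2 * m).+1)%N by rewrite muln_gt0 expn_gt0.
  split.
    have : (1 * (2 * m).+1 <= 2 ^ t * (2 * m).+1)%N by rewrite leq_mul2r expn_gt0.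
    by lia.
  rewrite /g prednK // lognM ?expn_gt0 // pfactorK //.
  by rewrite logn_coprime ?addn0 // coprime2n /= oddM.
have /choice[p hp] : forall n, exists p : nat * nat,
    (exists i, n = N i.+1 /\ p = ((N i).+1, g i)) \/
    ((forall i, n <> N i.+1) /\ p = (0%N, 0%N)).
  move=> n; have [[i ->]|h] := pselect (exists i, n = N i.+1).
    by exists ((N i).+1, g i); left; exists i.
  by exists (0%N, 0%N); right; split=> // i ni; apply: h; exists i.
exists (fun n => (p n).1), (fun n => (p n).2); split.
- by move=> n; have [[i [-> ->]]|[_ ->]] := hp n; first exact: NS.
- move=> n j; have [[i [-> ->]]|[_ ->]] //= := hp n.
  rewrite ltnS => jN; have [lt /(_ j jN)[h1 h2]] := hnext (N i).
  have jn : j <> next (N i) by move=> h; move: lt; rewrite -h ltnNge jN.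
  by split=> -[//|]; rewrite /diagonal /= => /esym ?; apply: jn.
- move=> n m nm; have [[i [ni ->]]|[_ ->]] := hp n; last by left.
  have [[j [mj ->]]|[_ ->]] := hp m; last by right.
  rewrite /= => le; exfalso; move: nm le; rewrite ni mj => nm.
  have ij : (i < j)%N.
    rewrite ltnNge; apply/negP; rewrite leq_eqVlt => /orP[/eqP ji|ji].
      by move: nm; rewrite ji ltnn.
    by move: nm; rewrite ltnNge ltnW // Nlt.
  apply/negP; rewrite -ltnNge ltnS; move: ij; rewrite leq_eqVlt => /orP[/eqP <- //|].
  by move=> /Nlt/ltnW.
- move=> n; have [[i [_ ->]]|[_ ->]] //= := hp n.
  by apply: leq_trans (gle i) _; apply: leq_trans (Nge i) _.
- move=> t m; have [i [mi gi]] := gt t m; exists (N i.+1).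
  have [[j [Nj ->]]|[h _]] := hp (N i.+1); last by case: (h i).
  have [<-] := Ninj _ _ Nj; split=> //=.
  by apply: leq_trans mi _; apply: leq_trans (Nge i) _.
Qed.

Theorem corollary6p1 (R : realType) (H : completeNormedModType R[i])
    (ip : {dot H for Num.conj}) (ip_norm : induces_norm ip)
    (H_separable : separable H) (H_infinite : infinite_dimensional H)
    (T : {linear H -> H}) (T_bounded : bounded_operator T)
    (T_spectrum : complex_interior (polynomial_hull (spectrum T)) 0)
    (k : nat) (k_gt0 : (0 < k)%N) :
  (exists2 delta : R, 0 < delta &
    forall (B : set (nat * nat)) (a : nat -> nat -> 'rV[R[i]]_k),
      admissible B ->
      (forall n : nat,
        (\esum_(j in [set j | (B `|` diagonal) (n, j)]) (supnorm (a n j))%:E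
           <= delta%:E)%E) ->
      (forall j : nat,
        (\esum_(n in [set n | (B `|` diagonal) (n, j)]) (supnorm (a n j))%:E
           <= delta%:E)%E) ->
      exists u : nat -> H, orthonormal_basis ip u /\
        forall (l : 'I_k) (n j : nat), (B `|` diagonal) (n, j) ->
          ip (iter l.+1 T (u j)) (u n) = a n j ord0 l) /\
  (forall B : set (nat * nat), admissible B ->
    exists u : nat -> H, orthonormal_basis ip u /\
      forall (l : 'I_k) (n j : nat), (B `|` diagonal) (n, j) ->
        ip (iter l.+1 T (u j)) (u n) = 0).
Proof.
set HH := hilbert_of_dot ip_norm.
suff main : exists2 delta : R, 0 < delta &
    forall (B : set (nat * nat)) (a : nat -> nat -> 'rV[R[i]]_k),
      admissible B ->
      (forall n : nat,
        (\esum_(j in [set j | (B `|` diagonal) (n, j)]) (supnorm (a n j))%:E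
           <= delta%:E)%E) ->
      (forall j : nat,
        (\esum_(n in [set n | (B `|` diagonal) (n, j)]) (supnorm (a n j))%:E
           <= delta%:E)%E) ->
      exists u : nat -> H, orthonormal_basis ip u /\
        forall (l : 'I_k) (n j : nat), (B `|` diagonal) (n, j) ->
          ip (iter l.+1 T (u j)) (u n) = a n j ord0 l.
  split=> // B aB; have [delta d0 hd] := main.
  have s0 : supnorm (0 : 'rV[R[i]]_k) = 0.
    rewrite /supnorm; elim/big_rec: _ => // l x _ ->.
    by rewrite mxE /cmod Normc.normc0 maxxx.
  have [||u [ou hu]] := hd B (fun _ _ => 0) aB.
  - by move=> n; rewrite esum1 ?lee_fin ?(ltW d0) // => j _; rewrite s0.
  - by move=> j; rewrite esum1 ?lee_fin ?(ltW d0) // => n _; rewrite s0.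
  by exists u; split=> // l n j nj; rewrite hu // mxE.
have bT : @bop R HH T by exact: bop_bounded.
have [r0 r00 hull] := hull_disc ip_norm T_spectrum.
have [eta eta0 direction] := numerical_range_direction_all bT k_gt0 r00 hull.
have [kap kap0 unit_comp] := prescribed_unit bT k_gt0 eta0 direction.
have arrow := prescribed_arrow bT kap0 unit_comp.
have [L L0 T_le] := iter_form_bounded k bT.
(* A row and a column together give [kap / 4], hence total linking mass at most 1/4 for each
   vector. *)
exists (kap / 8); first by rewrite divr_gt0.
move=> B a admB rows cols.
pose lk (n j : nat) : Prop := (B `|` diagonal) (n, j).
pose A n j : R := if (n, j) \in B `|` diagonal then supnorm (a n j) else 0.
pose aa n j l : R[i] := if (n, j) \in B `|` diagonal then
  (if insub l is Some l' then a n j ord0 l' else 0) else 0.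
have [prv [tg [s1 s2 s3 s4 s5]]] := schedule admB.
have [y [y0 y1 yd]] := dense_seq ip_norm H_separable.
have [||||||||u [ou lu cu]] := @basis_exists R HH T k bT kap L aa A kap0 arrow L0 T_le _ _ _ _
  lk prv (fun n => y (tg n)) y s1 _ _ _ y1 _ yd.
- by move=> i j; rewrite /A; case: ifP => // _; exact: supnorm_ge0.
- move=> i j l llk; rewrite /aa /A; case: ifP => _; last by rewrite Normc.normc0.
  by rewrite insubT; exact: cmod_le_supnorm.
- move=> i m.
  have := esum_partial_sum m (fun j => supnorm_ge0 (a i j)) (rows i).
  apply: le_trans; rewrite le_eqVlt; apply/orP; left; apply/eqP; apply: eq_bigr => j _.
  by rewrite /A.
- move=> j m.
  have := esum_partial_sum m (fun i => supnorm_ge0 (a i j)) (cols j).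
  apply: le_trans; rewrite le_eqVlt; apply/orP; left; apply/eqP; apply: eq_bigr => i _.
  by rewrite /A.
- by move=> n j jp; exact: s2.
- by move=> n m nm pn; have [->|->] := s3 n m nm pn; [left|right].
- by move=> n; exists (tg n).
- by move=> t m; have [n [mn tn]] := s5 t m; exists n; rewrite tn.
exists u; split.
  by split; [exact: ou|exact: complete_closure].
move=> l n j nj; rewrite [LHS](lu n j l nj (ltn_ord l)) /aa mem_set //.
by rewrite valK.
Qed.
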